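(* Let $n \ge 1$, $\ell \ge 0$ and $m$ be integers satisfying $n \ge 32\ell$ and $0 \le m \le \binom{n}{2} - \binom{n-\ell}{2}$. Then the lexicographic graph $\mathcal{L}_{n,2}(m)$ is a most probably intersecting graph on $[n]$ with $m$ edges; that is, for every $p \in [0,1]$ and every graph $G$ on vertex set $[n]$ with $m$ edges, $$\mathbb{P}(G_p \text{ is intersecting}) \le \mathbb{P}\big(\mathcal{L}_{n,2}(m)_p \text{ is intersecting}\big).$$
   Context: $[n]=\{1,\dots,n\}$, and $\binom{X}{k}$ denotes the set of $k$-element subsets of $X$. A graph on $[n]$ is identified with its edge set, a subset of $\binom{[n]}{2}$. A family $\mathcal{F}$ of sets is intersecting if $F_1 \cap F_2 \ne \emptyset$ for all $F_1, F_2 \in \mathcal{F}$ (the empty family is intersecting). For a family $\mathcal{F}$ and $p\in[0,1]$, $\mathcal{F}_p$ denotes the random subfamily obtained by retaining each set of $\mathcal{F}$ independently with probability $p$. The lexicographic order on $\binom{[n]}{k}$ is: for $A \ne B$, $A<B$ if $\min(A \triangle B) \in A$. $\mathcal{L}_{n,k}(m)$ is the family of the first $m$ sets of $\binom{[n]}{k}$ in this order. *)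

(* Defs.v *)
From mathcomp Require Import all_boot all_order all_algebra.
From mathcomp Require Import reals.

Set Implicit Arguments.
Unset Strict Implicit.
Unset Printing Implicit Defensive.

(* The ground set [n] = {1, ..., n} is 'I_n = {0, ..., n - 1}, with its usual
   order. *)

Definition ksubsets (n k : nat) : {set {set 'I_n}} :=
  [set A : {set 'I_n} | #|A| == k].

(* F1 and F2 may coincide: the empty set is in no intersecting family. *)
Definition intersecting (T : finType) (F : {set {set T}}) : bool :=
  [forall F1 in F, forall F2 in F, F1 :&: F2 != set0].

Definition symdiff (T : finType) (A B : {set T}) : {set T} :=
  (A :\: B) :|: (B :\: A).

(* min (A symdiff B) exists and lies in A; in particular A != B. *)
Definition lex_lt (n : nat) (A B : {set 'I_n}) : bool :=
  [exists i in symdiff A B,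
     [forall j in symdiff A B, (i <= j)%N] && (i \in A)].

Definition lex_le (n : nat) (A B : {set 'I_n}) : bool :=
  (A == B) || lex_lt A B.

Definition lex_family (n k m : nat) : {set {set 'I_n}} :=
  [set A in take m (sort (@lex_le n) (enum (ksubsets n k)))].

Section RandomSubfamily.
Local Open Scope ring_scope.
Variables (R : realType) (T : finType).
Implicit Types (p : R) (F H : {set {set T}}).

(* The law of F_p: the probability that F_p = H, for H a subfamily of F. *)
Definition subfamily_law p F H : R :=
  \prod_(A in F) (if A \in H then p else 1 - p).

Definition subfamily_prob p F (E : pred {set {set T}}) : R :=
  \sum_(H in powerset F | E H) subfamily_law p F H.

End RandomSubfamily.

Definition is_graph (n : nat) (G : {set {set 'I_n}}) : bool :=
  G \subset ksubsets n 2.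

Definition most_probably_intersecting_graph (R : realType) (n m : nat)
    (L : {set {set 'I_n}}) : Prop :=
  [/\ is_graph L, #|L| = m
    & forall (p : R) (G : {set {set 'I_n}}),
        (0 <= p <= 1)%R -> is_graph G -> #|G| = m ->
        (subfamily_prob p G (@intersecting 'I_n)
           <= subfamily_prob p L (@intersecting 'I_n))%R].

(* Main.v *)
Require Import Defs.
From mathcomp Require Import all_boot all_order all_algebra.
From mathcomp Require Import reals.
From mathcomp Require Import perm zify.

Set Implicit Arguments.
Unset Strict Implicit.
Unset Printing Implicit Defensive.

Import Order.TTheory GRing.Theory Num.Theory.

(** Intersecting graphs are rare: such a graph either has a vertex common to all
    its edges or is a triangle.  Hence, with d_v the degree of v and t the number
    of triangles of G, and up to terms that depend only on n, m and p, the
    probability that G_p is intersecting is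
      sum over k of (sum over v of C(d_v, k)) p^k (1-p)^(m-k) + t p^3 (1-p)^(m-3)
    ([intersecting_probE]).  All coefficients are nonnegative, so it is enough
    that the lexicographic graph maximises every star count sum_v C(d_v, k), and
    for k = 3 the star count plus t.

    Moving to the vertex i the neighbours of a later vertex j that i lacks
    increases all these quantities ([shifted_above]), so G may be taken shifted:
    earlier vertices see everything that later vertices see.  In a shifted graph
    charge a star to its edge with the latest leaf, and a triangle to the edge
    between its two latest vertices.  The counts become sums over the edges ij,
    i < j, of a weight g(i + b) + g(j - 1), where g is a binomial coefficient,
    b = 0 for stars and b = 1 for stars and triangles together ([starsE],
    [stars_trianglesE]).  Put the edge ij in the cell in row i and column j - 1.
    A shifted graph becomes a staircase: row i starts at the diagonal and the
    row lengths strictly decrease.  The lexicographic graph fills r rows of the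
    triangle 0 <= i <= y < c = n - 1 completely and a part of the next one.

    What is left is a packing problem, solved by [weight_le_lex]: among the
    staircases of a given size in this triangle, filling whole rows maximises
    the sum of g(i + b) + g(y) for every convex g with g(0) = 0.  The proof is
    by induction on the number q of rows.
    - A full first row can be deleted from both sides; this translates g.
    - If q = r + 1, the last column may be assumed empty, and the comparison of
      the optima of two consecutive triangles is a direct exchange.
    - If q > r + 1 and the last row is long, nothing is lost by putting its
      cells anywhere in the other rows.
    - If q > r + 1 and the last row is short, its cells are moved to the end of
      the first row.  By convexity nothing is lost if the first row is long
      enough.
    - Otherwise the staircase lives in the first 2 q - 3 columns.  Since g(x)/x
      is nondecreasing, its weight is then controlled by the sum of the
      coordinates of its cells, which is at most that of the far cells of the
      lexicographic staircase.
    The last case, and the exclusion of a short last row that ends close to the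
    right border, use n >= 32 l: it makes the number of rows small compared with
    the side of the triangle. *)

(** * Convex sequences and weighted staircases *)

Definition convex0 (g : nat -> nat) : Prop :=
  g 0 = 0 /\ forall x, 2 * g x.+1 <= g x + g x.+2.

Lemma convex0_slope g x y : convex0 g -> x <= y ->
  g x.+1 + g y <= g x + g y.+1.
Proof.
move=> [_ g2] /subnKC <-; elim: (y - x) => [|k IHk]; first by rewrite addn0; lia.
by rewrite addnS; have := g2 (x + k); lia.
Qed.

Lemma convex0_homo g x y : convex0 g -> x <= y -> g x <= g y.
Proof.
move=> gc /subnKC <-; elim: (y - x) => [|k IHk]; first by rewrite addn0.
rewrite addnS; have := convex0_slope gc (leq0n (x + k)); have [-> _] := gc; lia.
Qed.

(** Pushing two arguments apart, without decreasing their sum, cannot decrease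
    the sum of the values.  Every exchange of cells below is an instance. *)
Lemma convex0_spread g d a b e : convex0 g ->
  d <= a -> d <= b -> a + b <= d + e -> g a + g b <= g d + g e.
Proof.
move=> gc da db abde.
have shift t : g (d + t) + g b <= g d + g (b + t).
  elim: t => [|t IHt]; first by rewrite !addn0.
  have := @convex0_slope _ (d + t) (b + t) gc; rewrite leq_add2r => /(_ db).
  by rewrite !addnS; lia.
have := shift (a - d); rewrite subnKC // => /leq_trans; apply.
by rewrite leq_add2l (convex0_homo gc) //; lia.
Qed.

(** The slope g(x)/x from the origin is nondecreasing.  This reduces crude
    comparisons for g to comparisons of sums of coordinates. *)
Lemma convex0_star g x X : convex0 g -> x <= X -> X * g x <= x * g X.
Proof.
move=> gc; have [g0 g2] := gc.
have step y : y.+1 * g y <= y * g y.+1.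
  elim: y => [|y IHy]; first by rewrite g0.
  have := leq_mul (leqnn y.+1) (g2 y); lia.
move=> /subnKC <-; elim: (X - x) => [|k IHk]; first by rewrite addn0.
have := step (x + k); rewrite addnS; move: IHk.
case: (posnP (x + k)) => [xk0|xk0].
  have -> : x = 0 by lia.
  by rewrite g0 !muln0.
move=> IH st; rewrite -(leq_pmul2l xk0).
have := leq_mul (leqnn (x + k).+1) IH; have := leq_mul (leqnn x) st.
move: (x + k) (g x) (g _) (g _) => a A B C; lia.
Qed.

Lemma convex0_bin k : convex0 (fun x => 'C(x, k.+1)).
Proof.
split=> [|x]; first by rewrite bin0n.
by case: k => [|k]; rewrite !binS ?bin0 ?bin1 //; lia.
Qed.

(** Subtracting the constant restores the value 0 at the origin, so that the
    class of sequences is stable under deleting the first row of a staircase. *)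
Lemma convex0_shift g : convex0 g -> convex0 (fun x => g x.+1 - g 1).
Proof.
move=> gc; split=> [|x]; first by rewrite subnn.
have := gc.2 x.+1.
have H y : g 1 <= g y.+1 by apply: (convex0_homo gc).
by have := H x; have := H x.+1; have := H x.+2; lia.
Qed.

(** The row i of a staircase consists of the cells (i, i), ..., (i, i + u - 1).
    The offset b = 1 makes C(i + b, 2) = C(i, 2) + i account for triangles. *)
Definition row_weight (g : nat -> nat) (b i u : nat) : nat :=
  \sum_(k < u) (g (i + b) + g (i + k)).

Definition weight g b q (lam : nat -> nat) : nat :=
  \sum_(i < q) row_weight g b i (lam i).

(** Here r rows of the triangle 0 <= i <= y < c are full, and s cells are in the
    next row. *)
Definition lex_size c r s := \sum_(i < r) (c - i) + s.
Definition lex_weight g b c r s :=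
  \sum_(i < r) row_weight g b i (c - i) + row_weight g b r s.

(** Strict decrease of the lengths says that the end i + lam i of a row does not
    move to the right when i grows. *)
Definition strict_rows q (lam : nat -> nat) :=
  (forall i, i.+1 < q -> lam i.+1 < lam i) /\ (forall i, i < q -> 0 < lam i).

Lemma row_weightD g b i u v :
  row_weight g b i (u + v) =
  row_weight g b i u + \sum_(k < v) (g (i + b) + g (i + (u + k))).
Proof. by rewrite /row_weight big_split_ord. Qed.

Lemma row_weight_shift g b i u : convex0 g ->
  row_weight g b i.+1 u = row_weight (fun x => g x.+1 - g 1) b i u + u * (2 * g 1).
Proof.
move=> gc; rewrite /row_weight -[X in X * _]card_ord -sum_nat_const -big_split /=.
apply: eq_bigr => k _.
have H y : g 1 <= g y.+1 by apply: (convex0_homo gc).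
by rewrite /= !addSn; have := H (i + b); have := H (i + k); lia.
Qed.

(** Both sides contain the same full first row; below it, the cell (i + 1, y + 1)
    for g is the cell (i, y) for the translate of g, up to a constant that is
    counted once per cell. *)
Lemma lex_weight_strip g b c r s q lam : convex0 g -> lam 0 = c.+1 ->
  \sum_(i < q) lam i.+1 = lex_size c r s ->
  weight (fun x => g x.+1 - g 1) b q (fun i => lam i.+1)
    <= lex_weight (fun x => g x.+1 - g 1) b c r s ->
  weight g b q.+1 lam <= lex_weight g b c.+1 r.+1 s.
Proof.
move=> gc l0 sz le; rewrite /weight /lex_weight !big_ord_recl l0 subn0 -addnA leq_add2l.
under eq_bigr => i _ do rewrite (row_weight_shift _ _ _ gc).
under [X in _ <= X + _]eq_bigr => i _ do rewrite (row_weight_shift _ _ _ gc).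
rewrite (row_weight_shift _ _ _ gc) !big_split /= -!big_distrl /=.
rewrite addnACA -mulnDl leq_add //.
by rewrite -[X in _ <= X * _]/(lex_size c r s) -sz.
Qed.

Lemma lex_size_strip q c r s lam : lam 0 = c.+1 ->
  \sum_(i < q.+1) lam i = lex_size c.+1 r.+1 s ->
  \sum_(i < q) lam i.+1 = lex_size c r s.
Proof.
rewrite /lex_size !big_ord_recl subn0 => -> /eqP; rewrite -addnA eqn_add2l => /eqP.
by [].
Qed.

Lemma strict_rows_strip q lam : strict_rows q.+1 lam ->
  strict_rows q (fun i => lam i.+1).
Proof. by move=> [dec pos]; split=> i iq; [apply: dec | apply: pos]. Qed.

Lemma strict_rows_ub q lam i : strict_rows q lam -> i < q -> i + lam i <= lam 0.
Proof.
move=> [dec _]; elim: i => [|i IHi] iq //.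
by have := dec _ iq; have := IHi (ltnW iq); lia.
Qed.

Lemma strict_rows_lb q lam i : strict_rows q.+1 lam -> i <= q -> q - i + lam q <= lam i.
Proof.
move=> [dec _] iq; rewrite -{2}(subKn iq).
have: q - i <= q by apply: leq_subr.
elim: (q - i) => [|k IHk] kq; first by rewrite subn0.
have := dec (q - k.+1); rewrite subnSK // => /(_ _).
have := IHk (ltnW kq); lia.
Qed.

(** * The polynomial inequality behind the narrow case *)

Section Poly.
Local Open Scope ring_scope.
Implicit Types (r c s q : int).

(** For fixed q the minimum in c lies near 3 q, so for large q completing the
    square suffices and the values of q up to 20 are checked one by one. *)
Lemma narrow_poly_one_row c q : 63 <= c -> 3 <= q ->
  0 <= c * c - c - 6 * c * q - 15 * q * q + 2 * q * q * q + 28 * q - 24.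
Proof.
move=> c63 q3; have [q20|q20] := leP q 20.
  have [k [kq k20]] : exists k : nat, q = k%:Z /\ (k <= 20)%N.
    by exists `|q|%N; lia.
  move: q3; rewrite {}kq {q q20}.
  by do 21! [case: k k20 => [|k] k20; first by [move=> *; nia]]; lia.
have [t ->] : exists t, c = 3 * q + t by exists (c - 3 * q); lia.
have t2 : 0 <= t * (t - 1) by have [t0|t0] := leP t 0; nia.
have q2 : 0 <= q * (q - 21) by nia.
have q3' : 0 <= q * (q * (q - 21)) by nia.
lia.
Qed.

(** The leading form c^3 - 6 c^2 q - 4 c q^2 + 64 q^3 is
    64 q (q - c/5)^2 plus c times a positive definite quadratic form; the squares
    below combine to such a certificate that also absorbs the lower terms. *)
Lemma narrow_poly_many_rows c q : 63 <= c -> 3 <= q ->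
  0 <= (c - 31) * (c * c - c - 4 * q * q - 6 * c * q + 14 * q - 12)
       + 32 * (2 * q * q * q - 11 * q * q + 14 * q - 12).
Proof.
move=> c63 q3.
have S (a b : int) : 0 <= a -> 0 <= a * (b * b).
  by move=> a0; rewrite mulr_ge0 // -expr2 sqr_ge0.
have P (a b : int) : 0 <= a -> 0 <= b -> 0 <= a * b by apply: mulr_ge0.
have := S q (5 * q - c); have := S (c - 63) (5 * q - c).
have := S (c - 63) (4 * q - c); have := S (c - 63) (9 * q - 2 * c).
have := S 1 (5 * q - c); have := S 1 (4 * q - c); have := S 1 (9 * q - 2 * c).
have := S (c - 63) c; have := S (c - 63) q.
have := P (c - 63) q; have := P (c - 63) (c - 63); have := P (q - 3) (q - 3).
lia.
Qed.

(** This is twice the inequality needed in [weight_le_lex_narrow].  After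
    bounding s^2 - 6 q s below by - 9 q^2 and dropping a term r (r - 1) q, it is
    affine in r, so it is enough to
    treat the two ends r = 1 and 32 r = c - 31 of the range of r, according to
    the sign of the coefficient p of r. *)
Lemma narrow_poly r c s q : 1 <= r -> 0 <= s -> 32 * (r + 1) <= c + 1 -> 3 <= q ->
  3 * q * (2 * r * c - r * (r - 1) + 2 * s) + (r + 1) * ((2 * q - 3) * (2 * q - 4))
  <= r * (c * (c - 1)) + (r + s) * (r + s - 1) + 2 * (q * q * (q + 1)).
Proof.
move=> r1 s0 rc q3.
have P (a b : int) : 0 <= a -> 0 <= b -> 0 <= a * b by apply: mulr_ge0.
have A : s * s <= (r + s) * (r + s - 1).
  by have := P (r - 1) (r + s); have := P s (r - 1); lia.
have B : 0 <= (s - 3 * q) * (s - 3 * q) by rewrite -expr2 sqr_ge0.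
have D : 0 <= r * (r - 1) * q by rewrite !mulr_ge0 //; lia.
pose p := c * c - c - 4 * q * q - 6 * c * q + 14 * q - 12.
have C : 0 <= r * p + 2 * q * q * q - 11 * q * q + 14 * q - 12.
  have [p0|p0] := leP 0 p.
    by have := @narrow_poly_one_row c q; have := P (r - 1) p; rewrite /p in p0 *; lia.
  by have := @narrow_poly_many_rows c q; have := P (c - 31 - 32 * r) (- p);
     rewrite /p in p0 *; lia.
by rewrite /p in C; lia.
Qed.
End Poly.

(** * Moving cells of a staircase *)

Lemma weightS g b q lam :
  weight g b q.+1 lam = weight g b q lam + row_weight g b q (lam q).
Proof. by rewrite /weight big_ord_recr. Qed.

Lemma strict_rowsW p lam : strict_rows p.+1 lam -> strict_rows p lam.
Proof. by move=> [dec pos]; split=> i ip; [apply: dec | apply: pos]; lia. Qed.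

(** The cells can be listed row by row in one single row: since the rows above
    row p > 0 contain at least 2 p cells, the cell (p, p + k) is sent to a column
    that is at least the sum of its coordinates. *)
Lemma weight_le_star g b q lam : convex0 g -> b <= 1 -> strict_rows q lam ->
  weight g b q lam <= row_weight g b 0 (\sum_(i < q) lam i).
Proof.
move=> gc b1; elim: q => [|p IHp] rows; first by rewrite /weight big_ord0.
rewrite weightS big_ord_recr row_weightD leq_add ?IHp //; first exact: strict_rowsW.
case: p {IHp} rows => [|p] rows.
  by rewrite big_ord0 /row_weight leq_sum // => k _; rewrite add0n.
have size_ge : p.+1 * 2 <= \sum_(i < p.+1) lam i.
  rewrite -[X in X * _]card_ord -sum_nat_const leq_sum // => -[i /= ip] _.
  by have := strict_rows_lb rows (ltnW ip); have := rows.2 p.+1; lia.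
move: (\sum_(i < p.+1) lam i) size_ge => m size_ge.
by rewrite /row_weight leq_sum // => -[k kl] _ /=; apply: convex0_spread => //; lia.
Qed.

Lemma lex_sizeS c r s : r <= c ->
  lex_size c.+1 r s = lex_size c r (s + r).
Proof.
move=> rc; rewrite /lex_size addnA addnAC; congr (_ + _).
rewrite -[X in _ = _ + X]card_ord -sum1_card -big_split /=.
by apply: eq_bigr => -[i ir] _ /=; lia.
Qed.

(** Enlarging the triangle by one column moves r cells from the partial row to
    the ends of the r full rows: (r, r + s + i) goes to (i, c). *)
Lemma lex_weightS g b c r s : convex0 g -> b <= 1 -> 0 < s -> 2 * r + s <= c ->
  lex_weight g b c r (s + r) <= lex_weight g b c.+1 r s.
Proof.
move=> gc b1 s0 rsc; rewrite /lex_weight row_weightD addnA addnAC leq_add2r.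
rewrite -big_split leq_sum // => -[i ir] _ /=.
have -> : c.+1 - i = c - i + 1 by lia.
rewrite row_weightD leq_add2l big_ord1 /=.
by apply: convex0_spread => //; lia.
Qed.

(** With as few rows as possible no relation between r and c is needed.  If the
    first row does not reach the last column, no row does, and the column can be
    dropped at no loss by [lex_weightS]. *)
Lemma weight_le_lex_rows c g b r s lam : convex0 g -> b <= 1 -> 0 < s ->
  strict_rows r.+1 lam -> lam 0 <= c -> \sum_(i < r.+1) lam i = lex_size c r s ->
  weight g b r.+1 lam <= lex_weight g b c r s.
Proof.
move=> + b1 s0; elim: c => [|c IHc] in g r lam s s0 *.
  by move=> _ [_ /(_ 0 isT)]; lia.
move=> gc rows; rewrite leq_eqVlt => /orP[/eqP l0|l0] sz.
  case: r => [|r] in rows sz *.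
    have := weight_le_star gc b1 rows; rewrite sz.
    by rewrite /lex_weight /lex_size !big_ord0 !add0n.
  apply: lex_weight_strip => //; first exact: lex_size_strip sz.
  apply: IHc => //; first exact: convex0_shift.
  - exact: strict_rows_strip.
  - by have := rows.1 0; lia.
  - exact: lex_size_strip sz.
have rc : r < c.+1.
  by have := strict_rows_ub rows (ltnSn r); have := rows.2 r; lia.
have sz' := sz; rewrite lex_sizeS in sz' => //.
have cap : \sum_(i < r.+1) lam i <= \sum_(i < r.+1) (c - i).
  by rewrite leq_sum // => -[i ir] _ /=; have := strict_rows_ub rows ir; lia.
apply: leq_trans (IHc _ _ _ _ _ gc rows _ sz') _ => //; first by lia.
apply: lex_weightS => //; move: cap.
by rewrite sz' /lex_size big_ord_recr /= leq_add2l; lia.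
Qed.

Definition add_row0 (lam : nat -> nat) v i := if i is 0 then lam 0 + v else lam i.

(** The last v cells of the last row go to the end of the first row, in the same
    order; the hypothesis says that none loses in coordinate sum. *)
Lemma weight_move g b p v lam : convex0 g -> b <= 1 -> v <= lam p.+1 ->
  2 * p.+1 + lam p.+1 <= lam 0 + v ->
  weight g b p.+2 lam <=
    weight g b p.+1 (add_row0 lam v) + row_weight g b p.+1 (lam p.+1 - v).
Proof.
move=> gc b1 vl cond; rewrite weightS /weight !big_ord_recl /=.
have rowp : row_weight g b p.+1 (lam p.+1) = row_weight g b p.+1 (lam p.+1 - v)
    + \sum_(k < v) (g (p.+1 + b) + g (p.+1 + (lam p.+1 - v + k))).
  by rewrite -row_weightD subnK.
have cells : \sum_(k < v) (g (p.+1 + b) + g (p.+1 + (lam p.+1 - v + k)))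
    <= \sum_(k < v) (g (0 + b) + g (0 + (lam 0 + k))).
  by apply: leq_sum => -[k kv] _ /=; apply: convex0_spread => //; lia.
by rewrite {}rowp row_weightD -!addnA leq_add2l addnA addnC leq_add2r.
Qed.

Lemma size_move p v lam : v <= lam p.+1 ->
  \sum_(i < p.+1) add_row0 lam v i + (lam p.+1 - v) = \sum_(i < p.+2) lam i.
Proof.
by move=> vl; rewrite big_ord_recl [RHS]big_ord_recr big_ord_recl /=; lia.
Qed.

Lemma strict_rows_extend p lam c t : strict_rows p lam -> lam 0 <= c ->
  \sum_(i < p) lam i + t <= \sum_(i < p) (c - i) ->
  exists mu, [/\ strict_rows p mu, mu 0 <= c, forall i, lam i <= mu i
               & \sum_(i < p) mu i = \sum_(i < p) lam i + t].
Proof.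
move=> + l0; elim: t => [|t IHt] rows cap.
  by exists lam; rewrite addn0; split.
have [|mu [[dec pos] m0 lem sz]] := IHt rows; first by lia.
have room : exists i, (i < p) && (mu i < c - i).
  have [/existsP[i ci]|/existsPn ge] := boolP [exists i : 'I_p, mu i < c - i].
    by exists i; rewrite ltn_ord.
  suff : \sum_(i < p) (c - i) <= \sum_(i < p) mu i by lia.
  by rewrite leq_sum // => i _; rewrite leqNgt ge.
(* the first row with room is preceded by a full row, so it can be lengthened *)
case: (ex_minnP room) => j /andP[jp muj] jmin.
exists (fun i => mu i + (i == j)); split.
- split=> i ip; last by rewrite addn_gt0 pos.
  have lt_mu := dec _ ip; have [ij|_] := eqVneq i.+1 j; last first.
    by rewrite addn0 (leq_trans lt_mu) ?leq_addr.
  subst j; rewrite (ltn_eqF (ltnSn i)) addn0 addn1.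
  have : ~~ ((i < p) && (mu i < c - i)) by apply/negP=> /jmin; rewrite ltnn.
  by rewrite (ltnW ip) -leqNgt => /(leq_trans _); apply; move: muj; lia.
- by case: (eqVneq 0 j) => [j0|_]; [subst j; lia | rewrite addn0].
- by move=> i; rewrite (leq_trans (lem i)) ?leq_addr.
- rewrite big_split /= sz; have -> : \sum_(i < p) (i == j :> nat) = 1; last by rewrite addn1 addnS.
  rewrite (bigD1 (Ordinal jp)) // big1 => [|i] /=; first by rewrite eqxx.
  by rewrite -val_eqE /= => /negPf ->.
Qed.

Lemma sum_ord_double u : 2 * \sum_(k < u) k = u * u.-1.
Proof. by elim: u => [|[|u] IHu]; rewrite ?big_ord0 // big_ord_recr mulnDr IHu /=; lia. Qed.

(** Wherever they land, the cells of the last row arrive in the column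
    X = p + lam p just past that row or beyond, hence weigh at least g(X).  They weighed
    at most that much on average, because in a row with lam p > 2 p the average
    coordinate sum is at most X. *)
Lemma weight_replace g b p lam mu : convex0 g -> b <= 1 -> strict_rows p.+1 lam ->
  2 * p < lam p -> (forall i, lam i <= mu i) ->
  \sum_(i < p) mu i = \sum_(i < p) lam i + lam p ->
  weight g b p.+1 lam <= weight g b p mu.
Proof.
move=> gc b1 rows long lem sz; set X := p + lam p.
have grow i : i < p ->
    row_weight g b i (lam i) + (mu i - lam i) * g X <= row_weight g b i (mu i).
  move=> ip; rewrite -{2}(subnKC (lem i)) row_weightD leq_add2l.
  rewrite -{1}[mu i - lam i]card_ord -sum_nat_const.
  rewrite leq_sum // => k _; rewrite (leq_trans _ (leq_addl _ _)) // convex0_homo //.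
  by rewrite /X; have := strict_rows_lb rows (ltnW ip); lia.
have last : row_weight g b p (lam p) <= lam p * g X.
  have X0 : 0 < X by rewrite /X; lia.
  rewrite -(leq_pmul2l X0) /row_weight big_distrr /=.
  apply: (@leq_trans (\sum_(k < lam p) (p + b + (p + k)) * g X)).
    apply: leq_sum => k _; rewrite mulnDr mulnDl.
    by rewrite leq_add // convex0_star // /X; have := ltn_ord k; lia.
  rewrite -big_distrl mulnA leq_mul2r; apply/orP; right.
  under eq_bigr do rewrite addnA.
  rewrite big_split /= sum_nat_const card_ord.
  rewrite -(leq_pmul2l (isT : 0 < 2)) mulnDr sum_ord_double /X.
  have := leq_mul (leqnn (lam p)) long; nia.
rewrite weightS; apply: leq_trans (leq_add (leqnn _) last) _.
apply: (@leq_trans (\sum_(i < p) (row_weight g b i (lam i) + (mu i - lam i) * g X))).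
  rewrite big_split leq_add2l -big_distrl leq_mul2r; apply/orP; right.
  rewrite -(leq_add2l (\sum_(i < p) lam i)) -sz -big_split.
  by rewrite leq_sum // => i _; rewrite /= subnKC.
by rewrite leq_sum // => -[i ip] _; apply: grow.
Qed.

(** * Filling whole rows is optimal *)

Lemma bin2_double u : 2 * 'C(u, 2) = u * u.-1.
Proof. by elim: u => [|[|u] IHu] //; rewrite binS mulnDr IHu bin1 /=; lia. Qed.

Lemma lex_size_double c r s : r <= c ->
  2 * lex_size c r s + r * r.-1 = 2 * r * c + 2 * s.
Proof.
move=> rc; rewrite /lex_size -sum_ord_double -mulnDr addnAC -big_split /=.
under eq_bigr => i _ do rewrite subnK ?(leq_trans (ltnW (ltn_ord i))) //.
by rewrite sum_nat_const card_ord; lia.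
Qed.

(** Only the cells in columns y >= Y are kept, for which
    Y g(y) >= y g(Y). *)
Lemma row_weight_lb g b i u Y : convex0 g -> i <= Y ->
  g Y * ('C(i + u, 2) - 'C(Y, 2)) <= Y * row_weight g b i u.
Proof.
move=> gc iY; have [uY|Yu] := leqP (i + u) Y.
  by rewrite (eqP (_ : 'C(i + u, 2) - 'C(Y, 2) == 0)) ?muln0 // subn_eq0 leq_bin2l.
have [v uv] : exists v, u = Y - i + v by exists (i + u - Y); lia.
rewrite {}uv {u Yu} row_weightD addnA subnKC //.
have -> : 'C(Y + v, 2) - 'C(Y, 2) = \sum_(k < v) (Y + k).
  elim: v => [|v IHv]; first by rewrite addn0 big_ord0 subnn.
  have := leq_bin2l 2 (leq_addr v Y).
  by rewrite big_ord_recr /= -IHv addnS binS bin1; lia.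
rewrite mulnDr (leq_trans _ (leq_addl _ _)) // !big_distrr leq_sum //= => k _.
rewrite addnA subnKC // mulnC (leq_trans (convex0_star gc (leq_addr k Y))) //.
by rewrite leq_mul2l leq_addl orbT.
Qed.

Lemma staircase_sum b q :
  2 * \sum_(i < q) \sum_(k < q - i) (i + b + (i + k)) = q * q.+1 * (q.-1 + b).
Proof.
elim: q => [|q IHq]; first by rewrite big_ord0.
rewrite big_ord_recr /= subSnn big_ord1.
under eq_bigr => i _ do rewrite subSn ?(ltnW (ltn_ord i)) // big_ord_recr /=.
rewrite big_split /= !mulnDr IHq.
have -> : \sum_(i < q) (i + b + (i + (q - i))) = \sum_(i < q) i + q * (b + q).
  have <- : \sum_(i < q) (b + q) = q * (b + q) by rewrite sum_nat_const card_ord.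
  rewrite -big_split /=.
  by apply: eq_bigr => -[i iq] _ /=; lia.
have := sum_ord_double q; move: (\sum_(i < q) i) => S.
by case: q {IHq} => [|q] /=; lia.
Qed.

(** A staircase with q rows contains the full triangle of side q, whose average
    coordinate sum is q - 1, and each remaining cell contributes at most 3 q. *)
Lemma coord_sum_ub b q lam : b <= 1 -> strict_rows q lam -> lam 0 <= 2 * q - 3 ->
  \sum_(i < q) \sum_(k < lam i) (i + b + (i + k)) + q * q * q.+1
    <= 3 * q * \sum_(i < q) lam i.
Proof.
move=> b1 rows l0.
have row i : i < q -> \sum_(k < lam i) (i + b + (i + k)) <=
    \sum_(k < q - i) (i + b + (i + k)) + (lam i - (q - i)) * (3 * q).
  case: q rows l0 => // p rows l0 ip.
  have lb := strict_rows_lb rows ip; have p_pos := rows.2 p (ltnSn p).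
  have ub := strict_rows_ub rows ip.
  have [v vE] : exists v, lam i = p.+1 - i + v by exists (lam i - (p.+1 - i)); lia.
  rewrite vE in ub *; rewrite addKn big_split_ord leq_add2l.
  have <- : \sum_(k < v) 3 * p.+1 = v * (3 * p.+1) by rewrite sum_nat_const card_ord.
  by rewrite leq_sum //= => -[k kl] _ /=; lia.
have tot : \sum_(i < q) (q - i) + \sum_(i < q) (lam i - (q - i)) = \sum_(i < q) lam i.
  rewrite -big_split; apply: eq_bigr => -[i iq] _ /=; rewrite subnKC //.
  case: q rows iq {l0 row} => // p rows iq.
  by have := strict_rows_lb rows iq; have := rows.2 p (ltnSn p); lia.
have stair : 2 * \sum_(i < q) (q - i) = q * q.+1.
  elim: q {rows l0 row tot} => [|q IHq]; first by rewrite big_ord0.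
  by rewrite big_ord_recl subn0 mulnDr /= IHq; lia.
have : \sum_(i < q) \sum_(k < lam i) (i + b + (i + k)) <=
    \sum_(i < q) \sum_(k < q - i) (i + b + (i + k))
      + (\sum_(i < q) (lam i - (q - i))) * (3 * q).
  by rewrite big_distrl -big_split leq_sum //= => -[i iq] _; apply: row.
have := staircase_sum b q; rewrite -tot.
move: (\sum_(i < q) (q - i)) stair (\sum_(i < q) (lam i - _)) => x xE y.
move: (\sum_(i < q) _) (\sum_(i < q) _) => D S SE DS.
have : 3 * q * (2 * x) = 3 * q * (q * q.+1) by rewrite xE.
suff : q * q.+1 * (q.-1 + b) <= q * q.+1 * q by lia.
have [->|q0] := posnP q; first by rewrite !mul0n.
by rewrite leq_mul2l; apply/orP; right; lia.
Qed.

Lemma narrow_size_bound r s c q m C1 C2 C3 D :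
  0 < r -> 32 * r.+1 <= c.+1 -> 2 < q ->
  2 * m + r * r.-1 = 2 * r * c + 2 * s ->
  2 * C1 = c * c.-1 -> 2 * C2 = (2 * q - 3) * (2 * q - 3).-1 ->
  2 * C3 = (r + s) * (r + s).-1 ->
  D + q * q * q.+1 <= 3 * q * m ->
  D <= r * (C1 - C2) + (C3 - C2).
Proof.
move=> r0 rc q2 mE E1 E2 E3 DE.
have [z1 [z3 [-> -> z1E z3E]]] : exists z1 z3, [/\ C1 - C2 = z1, C3 - C2 = z3,
    C1 <= z1 + C2 & C3 <= z3 + C2].
  by exists (C1 - C2), (C3 - C2); split=> //; lia.
have poly := @narrow_poly r c s q.
have {}poly : (3 * q%:Z * (2 * m%:Z) + (r%:Z + 1) * (2 * C2%:Z)
    <= r%:Z * (2 * C1%:Z) + 2 * C3%:Z + 2 * (q%:Z * q%:Z * (q%:Z + 1)))%R.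
  have -> : (2 * m%:Z = 2 * r%:Z * c - r%:Z * (r%:Z - 1) + 2 * s%:Z)%R.
    by case: r r0 mE {rc E3 poly} => // r _ /=; lia.
  have -> : (2 * C1%:Z = c%:Z * (c%:Z - 1))%R.
    by case: c E1 {rc mE poly} => [|c] /=; lia.
  have -> : (2 * C3%:Z = (r + s)%:Z * ((r + s)%:Z - 1))%R.
    by case: (r + s) E3 => [|x] /=; lia.
  have -> : (2 * C2%:Z = (2 * q%:Z - 3) * (2 * q%:Z - 4))%R.
    case: q q2 E2 {DE poly} => [|[|[|q]]] // _ E2;
       have {}E2 : 2 * C2 = (2 * q + 3) * (2 * q + 2) by rewrite E2; congr (_ * _); lia.
    lia.
  by rewrite PoszD; apply: poly; lia.
have := leq_mul (leqnn r) z1E; lia.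
Qed.

(** All p + 1 rows reach at least as far as the last one, so a short last row
    that ends close to the right border would force too many cells. *)
Lemma tight_row_absurd r s c p u m a : s <= c - r -> r <= c ->
  32 * r.+1 <= c.+1 -> 0 < u -> u <= 2 * p -> c < 2 * p + u ->
  2 * m + r * r.-1 = 2 * r * c + 2 * s ->
  2 * a = p.+1 * p -> p.+1 * u + a <= m -> False.
Proof.
move=> sc rl rc u0 up cu mE aE ma.
have m_ub : 2 * m <= 2 * (r.+1 * c) by lia.
have m_ub' : 32 * r.+1 * c <= c.+1 * c by rewrite leq_mul2r rc orbT.
have c_ub : c.+1 * c <= (2 * p + u) * (2 * p + u).-1 by apply: leq_mul; lia.
have u_ub : u * u <= u * (2 * p) by rewrite leq_mul2l up orbT.
have p0 : 0 < p by lia.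
have [x xE] : exists x, 2 * p + u = x.+1 by exists (2 * p + u).-1; lia.
by move: c_ub; rewrite xE /=; nia.
Qed.

(** The slope g(Y)/Y at Y = 2 q - 3 bounds the weights of all cells of the narrow
    staircase from above, and those of the cells of the lexicographic staircase
    in columns y >= Y from below. *)
Lemma weight_le_lex_narrow g b q c r s lam : convex0 g -> b <= 1 ->
  strict_rows q lam -> r.+2 <= q -> 0 < r -> s <= c - r -> 32 * r.+1 <= c.+1 ->
  lam 0 <= 2 * q - 3 -> \sum_(i < q) lam i = lex_size c r s ->
  weight g b q lam <= lex_weight g b c r s.
Proof.
move=> gc b1 rows rq r0 sc rc l0 sz; set Y := 2 * q - 3.
have Y0 : 0 < Y by rewrite /Y; lia.
rewrite -(leq_pmul2l Y0).
have upper : Y * weight g b q lam <=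
    g Y * \sum_(i < q) \sum_(k < lam i) (i + b + (i + k)).
  rewrite /weight !big_distrr /= leq_sum // => -[i iq] _ /=.
  have ub := strict_rows_ub rows iq.
  rewrite /row_weight !big_distrr leq_sum //= => -[k kl] _ /=.
  rewrite mulnDr [g Y * _]mulnC mulnDl.
  by rewrite leq_add // convex0_star // /Y; lia.
have lower : g Y * (\sum_(i < r) ('C(c, 2) - 'C(Y, 2)) + ('C(r + s, 2) - 'C(Y, 2)))
    <= Y * lex_weight g b c r s.
  rewrite /lex_weight !mulnDr leq_add //; last first.
    by apply: row_weight_lb => //; rewrite /Y; lia.
  rewrite !big_distrr leq_sum //= => -[i ir] _ /=.
  rewrite -{1}(subnKC (_ : i <= c)); last by lia.
  by apply: row_weight_lb => //; rewrite /Y; lia.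
apply: leq_trans upper (leq_trans _ lower); rewrite leq_mul2l; apply/orP; right.
rewrite sum_nat_const card_ord.
have D_ub := coord_sum_ub b1 rows l0; rewrite sz in D_ub.
by apply: (@narrow_size_bound r s c q (lex_size c r s)); rewrite ?bin2_double ?lex_size_double //; lia.
Qed.

(** Induction on the number of rows: unless the comparison is direct, either the
    last row is emptied or the first one is full and can be stripped. *)
Theorem weight_le_lex q : forall g b c r s lam, convex0 g -> b <= 1 ->
  strict_rows q lam -> lam 0 <= c -> 0 < s <= c - r -> 32 * r.+1 <= c.+1 ->
  \sum_(i < q) lam i = lex_size c r s ->
  weight g b q lam <= lex_weight g b c r s.
Proof.
elim: q => [|p IHp] g b c r s lam gc b1 rows l0 /andP[s0 sc] rc sz.
  by rewrite /weight big_ord0.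
have cap : \sum_(i < p.+1) lam i <= \sum_(i < p.+1) (c - i).
  by rewrite leq_sum // => -[i ip] _ /=; have := strict_rows_ub rows ip; lia.
have capE u : u <= r -> lex_size c r s <= \sum_(i < u) (c - i) -> False.
  move=> ur; rewrite /lex_size -(subnKC ur) big_split_ord /=.
  by move=> H; have : 0 < s := s0; lia.
have rp : r <= p by rewrite leqNgt; apply/negP => /capE; apply; rewrite -sz.
have [rE|rneq] := eqVneq r p.
  by subst r; apply: weight_le_lex_rows.
have {rneq}rp : r < p by rewrite ltn_neqAle rneq.
have [r0|r0] := posnP r.
  have := weight_le_star gc b1 rows; rewrite sz r0.
  by rewrite /lex_weight /lex_size !big_ord0 !add0n.
case: c => [|c] in l0 sc rc sz cap capE *; first by lia.
case: r => // r in r0 rp sc rc sz capE *.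
have strip g' lam' : convex0 g' -> strict_rows p.+1 lam' -> lam' 0 = c.+1 ->
    \sum_(i < p.+1) lam' i = lex_size c.+1 r.+1 s ->
    weight g' b p.+1 lam' <= lex_weight g' b c.+1 r.+1 s.
  move=> g'c rows' l0' sz'; have sz'' := lex_size_strip l0' sz'.
  apply: lex_weight_strip => //; apply: IHp => //; first exact: convex0_shift.
  - exact: strict_rows_strip.
  - by have := rows'.1 0; lia.
  - by apply/andP; split; lia.
  - by lia.
have [l0c|l0c] := eqVneq (lam 0) c.+1; first exact: strip.
set u := lam p.
have [long|short] := ltnP (2 * p) u.
  have [|mu [rows' mu0 lem szmu]] := @strict_rows_extend p lam c.+1 u (strict_rowsW rows) l0.
    have -> : \sum_(i < p) lam i + u = lex_size c.+1 r.+1 s by rewrite -sz big_ord_recr.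
    have -> : p = r.+2 + (p - r.+2) by lia.
    rewrite big_split_ord /= (leq_trans _ (leq_addr _ _)) //.
    by rewrite /lex_size [X in _ <= X]big_ord_recr /= leq_add2l; lia.
  apply: leq_trans (weight_replace gc b1 rows long lem szmu) _.
  apply: IHp => //; first by apply/andP; split; lia.
  by rewrite szmu -sz big_ord_recr.
case: p => [|p] in IHp rows sz cap rp strip u short *; first by lia.
have u0 : 0 < u := rows.2 _ (ltnSn _).
have dec := rows.1; have pos := rows.2.
have [room|tight] := leqP u (c.+1 - lam 0).
  have [wide|narrow] := leqP (2 * p.+1) (lam 0); last first.
    by apply: weight_le_lex_narrow => //; lia.
  apply: leq_trans (@weight_move g b p u lam gc b1 (leqnn _) _) _; first by lia.
  rewrite subnn /row_weight big_ord0 addn0; apply: IHp => //.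
  - split=> [[|i]|[|i]] ip //=; last by apply: pos; lia.
      by rewrite (leq_trans (dec 0 _)) ?leq_addr //; lia.
    by apply: dec; lia.
    by rewrite addn_gt0 pos.
  - by rewrite /=; lia.
  - by apply/andP; split; lia.
  - by rewrite -sz -(@size_move p u) // subnn addn0.
set v := c.+1 - lam 0.
have full : lam 0 + v = c.+1 by rewrite subnKC.
(* the part v of the last row fills up the first row, which is then stripped *)
have fits : 2 * p.+1 + u <= lam 0 + v.
  rewrite leqNgt; apply/negP => far.
  have size_lb : p.+2 * u + \sum_(i < p.+2) i <= \sum_(i < p.+2) lam i.
    have <- : \sum_(i < p.+2) (p.+1 - i) = \sum_(i < p.+2) i.
      by rewrite (reindex_inj rev_ord_inj); apply: eq_bigr => -[i ip] _ /=; lia.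
    have <- : \sum_(i < p.+2) u = p.+2 * u by rewrite sum_nat_const card_ord.
    rewrite -big_split leq_sum //= => -[i ip] _ /=.
    by rewrite addnC; apply: strict_rows_lb.
  have := @lex_size_double c.+1 r.+1 s; have := sum_ord_double p.+2.
  rewrite -sz; move: (\sum_(i < p.+2) _) (\sum_(i < p.+2) _) size_lb => m a ma aE mE.
  by apply: (@tight_row_absurd r.+1 s c.+1 p.+1 u m a) => //; rewrite ?mE //; lia.
pose lam' i := if i == p.+1 then u - v else add_row0 lam v i.
have lam'E i : i < p.+1 -> lam' i = add_row0 lam v i.
  by move=> ip; rewrite /lam' ltn_eqF.
have lam'p : lam' p.+1 = u - v by rewrite /lam' eqxx.
apply: leq_trans (@weight_move g b p v lam gc b1 _ fits) _; first by lia.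
have -> : weight g b p.+1 (add_row0 lam v) + row_weight g b p.+1 (lam p.+1 - v)
    = weight g b p.+2 lam'.
  rewrite [RHS]weightS lam'p; congr (_ + _).
  by apply: eq_bigr => -[i ip] _ /=; rewrite lam'E.
apply: strip => //.
- have uE i : i = p.+1 -> u = lam i by move=> ->.
  split=> i ip; rewrite /lam'.
    have := dec i ip; rewrite (ltn_eqF (_ : i < p.+1)) //.
    by case: eqP => [/uE->|_]; case: i ip => [|i] ip /=; lia.
  case: eqP => [_|_]; first by lia.
  by case: i ip => [|i] ip /=; [rewrite addn_gt0 pos | apply: pos].
- rewrite -sz -(@size_move p v lam); last exact: ltnW.
  rewrite big_ord_recr /= lam'p; congr (_ + _).
  by apply: eq_bigr => -[i ip] _ /=; rewrite lam'E.
Qed.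

(** * Star and triangle counts of shifted graphs *)

Lemma sum_ord_interval (F : nat -> nat) N a b : b <= N ->
  \sum_(j < N | a <= j < b) F j = \sum_(k < b - a) F (a + k).
Proof.
move=> bN; under [RHS]eq_bigr do rewrite addnC.
rewrite -(big_mkord xpredT (fun k => F (k + a))) /=.
rewrite -(big_addn 0 b a xpredT F) add0n (big_nat_widen a _ _ _ _ bN) big_geq_mkord.
by apply: eq_bigl => j; rewrite andbC.
Qed.

Lemma count_ord_interval N a b : b <= N -> \sum_(j < N | a <= j < b) 1 = b - a.
Proof.
by move=> bN; rewrite (sum_ord_interval (fun=> 1)) // sum_nat_const card_ord muln1.
Qed.

(** Sort the (k + 1)-subsets of P by their largest element. *)
Lemma bin_sum_prefix (P : nat -> bool) N k :
  'C(\sum_(w < N) P w, k.+1) = \sum_(w < N) P w * 'C(\sum_(u < w) P u, k).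
Proof.
elim: N => [|N IHN]; first by rewrite !big_ord0.
rewrite !big_ord_recr /= -IHN.
by case: (P N); rewrite ?addn1 ?addn0 ?mul1n ?binS.
Qed.

Lemma sum_neq_ord v w : \sum_(u < w) (u != v :> nat) = w - (v < w).
Proof.
elim: w => [|w IHw]; first by rewrite big_ord0.
by rewrite big_ord_recr IHw /=; lia.
Qed.

(** Graphs on the vertices 0, ..., N - 1 are given here by a relation on nat, so
    that vertices can be shifted by arithmetic. *)
Section ShiftedGraph.
Variables (N : nat) (E : nat -> nat -> bool).

Definition shifted := [/\ symmetric E, irreflexive E &
  forall i j w, i < j -> j < N -> w < N -> w != i -> E j w -> E i w].

Definition degree v := \sum_(w < N) E v w.
Definition stars k := \sum_(v < N) 'C(degree v, k).
Definition triangles :=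
  \sum_(x < N) \sum_(y < N) \sum_(z < N) [&& x < y, y < z, E x y, E y z & E x z].
Definition upper v := \sum_(w < N | v < w) E v w.

Hypothesis shE : shifted.
Let symE : symmetric E. Proof. by case: shE. Qed.
Let irrE : irreflexive E. Proof. by case: shE. Qed.

Lemma shifted_le i j w : i <= j -> j < N -> w < N -> w != i -> E j w -> E i w.
Proof.
case: shE => _ _ sh; rewrite leq_eqVlt => /orP[/eqP-> //|ij]; exact: sh.
Qed.

(** The later neighbours of v form an interval that starts right after v. *)
Lemma shifted_upper v w : v < w < N -> E v w = (w <= v + upper v).
Proof.
move=> /andP[vw wN]; apply/idP/idP => [vEw|].
  suff: w - v <= upper v by lia.
  have := count_ord_interval v.+1 wN; rewrite subSS => <-.
  rewrite /upper big_mkcond [X in _ <= X]big_mkcond leq_sum //= => -[u uN] _ /=.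
  case: ifP => //; rewrite ltnS => /andP[vu uw]; rewrite vu symE.
  have uEv : E u v by apply: (@shifted_le u w v); rewrite 1?symE // ?neq_ltn ?vu ?(ltn_trans vu uN).
  by rewrite uEv.
apply: contraLR => nvEw; rewrite -ltnNge.
suff: upper v <= w - v.+1 by lia.
rewrite -(count_ord_interval v.+1 (ltnW wN)).
rewrite /upper big_mkcond [X in _ <= X]big_mkcond leq_sum //= => -[u uN] _ /=.
case: ifP => // vu; have [_|wu] := ltnP u w; first by case: (E v u).
rewrite [E v u]negbTE //; apply: contra nvEw => vEu; rewrite symE.
apply: (shifted_le wu) => //; first exact: ltn_trans vw wN.
  by rewrite neq_ltn vw.
by rewrite symE.
Qed.

Lemma upper_bound v : v < N -> v + upper v < N.
Proof.
move=> vN; suff : upper v <= N - v.+1 by lia.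
rewrite -(count_ord_interval v.+1 (leqnn N)).
rewrite /upper big_mkcond [X in _ <= X]big_mkcond leq_sum //= => -[u uN] _ /=.
by rewrite uN andbT; case: ifP => // _; case: E.
Qed.

Lemma upper_out v : N <= v -> upper v = 0.
Proof. by move=> Nv; apply: big_pred0 => -[w wN] /=; lia. Qed.

Lemma upper_step v : upper v.+1 <= (upper v).-1.
Proof.
have [u0|u0] := posnP (upper v.+1); first by rewrite u0.
have vN : v.+1 < N by rewrite ltnNge; apply/negP => /upper_out; lia.
have ub := upper_bound vN; set w := v.+1 + upper v.+1 in ub.
have wE : E v.+1 w by rewrite shifted_upper ?leqnn // ub /w; lia.
have : E v w by apply: shifted_le wE => //; rewrite /w; lia.
by rewrite shifted_upper; rewrite /w in ub *; lia.
Qed.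

Lemma sum_upper (F : nat -> nat -> nat) :
  \sum_(v < N) \sum_(w < N | v < w) E v w * F v w =
  \sum_(v < N) \sum_(k < upper v) F v (v + k).+1.
Proof.
apply: eq_bigr => -[v vN] _ /=.
have := @sum_ord_interval (F v) N v.+1 (v + upper v).+1 (upper_bound vN).
rewrite subSS addKn; under [in RHS]eq_bigr do rewrite addSn; move=> <-.
rewrite big_mkcond [RHS]big_mkcond; apply: eq_bigr => -[w wN] _ /=.
by have [vw|//] := ltnP v w; rewrite shifted_upper ?vw // ltnS; case: leqP; rewrite ?mul1n.
Qed.

(** Everything before a neighbour of v, except v itself, is a neighbour of v. *)
Lemma shifted_prefix v w : v < N -> w < N -> E v w -> \sum_(u < w) E v u = w - (v < w).
Proof.
move=> vN wN vEw; rewrite -sum_neq_ord; apply: eq_bigr => -[u uw] _ /=.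
have [->|uv] := eqVneq u v; first by rewrite irrE.
by rewrite symE (@shifted_le _ w) // 1?symE ?(ltnW uw) // eq_sym.
Qed.

Lemma sum_pairs (F : nat -> nat -> nat) :
  \sum_(v < N) \sum_(w < N) E v w * F v w =
  \sum_(v < N) \sum_(w < N | v < w) E v w * (F v w + F w v).
Proof.
under [RHS]eq_bigr do (under eq_bigr do rewrite mulnDr; rewrite big_split /=).
rewrite big_split /= [X in _ = _ + X](exchange_big_dep xpredT) //= -big_split /=.
apply: eq_bigr => -[v vN] _ /=.
rewrite big_mkcond [X in _ = _ + X]big_mkcond [X in _ = X + _]big_mkcond -big_split /=.
apply: eq_bigr => -[w wN] _ /=; rewrite [E w v]symE.
by case: (ltngtP v w) => [||->]; rewrite ?addn0 ?irrE.
Qed.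

(** Charge a star with k + 1 leaves to the edge vw from its centre v to its
    latest leaf w: the other leaves are any k of the vertices before w, except v
    when v < w.  This gives C(w - 1, k) for v < w and C(w, k) for w < v. *)
Lemma starsE k : stars k.+1 = weight (fun x => 'C(x, k)) 0 N upper.
Proof.
have -> : stars k.+1 = \sum_(v < N) \sum_(w < N) E v w * 'C(w - (v < w), k).
  apply: eq_bigr => -[v vN] _ /=; rewrite /degree bin_sum_prefix.
  apply: eq_bigr => -[w wN] _ /=; case: (boolP (E v w)) => // vEw.
  by rewrite shifted_prefix.
rewrite (sum_pairs (fun v w => 'C(w - (v < w), k))).
rewrite (sum_upper (fun v w => 'C(w - (v < w), k) + 'C(v - (w < v), k))) /weight.
apply: eq_bigr => -[v vN] _ /=; apply: eq_bigr => -[j jv] _ /=.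
rewrite addnC ltnS leq_addr subn1 addn0 /=.
by have -> : ((v + j).+1 < v) = false; [lia | rewrite subn0].
Qed.

(** Any vertex before the earlier end of an edge completes it to a triangle. *)
Lemma trianglesE : triangles = \sum_(v < N) \sum_(w < N | v < w) E v w * v.
Proof.
rewrite /triangles exchange_big /=; apply: eq_bigr => -[y yN] _ /=.
rewrite exchange_big [RHS]big_mkcond /=; apply: eq_bigr => -[z zN] _ /=.
have [yz|_] := ltnP y z; last by rewrite big1 // => x _; rewrite andbF.
case: (boolP (E y z)) => yEz; last by rewrite mul0n big1 // => x _; rewrite !andbF.
rewrite mul1n -[RHS]subn0 -(count_ord_interval 0 (ltnW yN)).
rewrite [RHS]big_mkcond /=.
apply: eq_bigr => -[x xN] _ /=; have [xy|//] := ltnP x y.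
have xz := ltn_trans xy yz.
have -> : E x z by apply: (shifted_le (ltnW xy)) => //; rewrite gtn_eqF.
have -> // : E x y.
by apply: (shifted_le (ltnW xz)) => //; [rewrite gtn_eqF | rewrite symE].
Qed.

Lemma stars_trianglesE : stars 3 + triangles = weight (fun x => 'C(x, 2)) 1 N upper.
Proof.
rewrite starsE trianglesE (sum_upper (fun v _ => v)) /weight -big_split /=.
apply: eq_bigr => -[v vN] _ /=; rewrite /row_weight -big_split /=.
by apply: eq_bigr => k _; rewrite addn0 addn1 binS bin1; lia.
Qed.

Lemma degree_sum : \sum_(v < N) degree v = 2 * \sum_(v < N) upper v.
Proof.
have -> : \sum_(v < N) degree v = stars 1 by apply: eq_bigr => v _; rewrite bin1.
rewrite starsE big_distrr; apply: eq_bigr => v _.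
rewrite /row_weight; under eq_bigr do rewrite !bin0.
by rewrite sum_nat_const card_ord mulnC.
Qed.

Lemma upper_rows : exists2 q, q <= N & strict_rows q upper /\ forall i, q <= i -> upper i = 0.
Proof.
have ex0 : exists i, upper i == 0 by exists N; rewrite upper_out.
case: (ex_minnP ex0) => q /eqP q0 qmin; exists q.
  by apply: qmin; rewrite upper_out.
have pos i : i < q -> 0 < upper i.
  by move=> iq; rewrite lt0n; apply/negP => /qmin; rewrite leqNgt iq.
split; first split=> // i iq.
  by have := upper_step i; have := pos i (ltnW iq); lia.
move=> i /subnKC <-; elim: (i - q) => [|d IHd]; first by rewrite addn0.
by have := upper_step (q + d); rewrite addnS IHd; lia.
Qed.

Lemma sum_rows q (F : nat -> nat -> nat) : q <= N ->
  (forall i, q <= i -> upper i = 0) -> (forall i, F i 0 = 0) ->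
  \sum_(i < N) F i (upper i) = \sum_(i < q) F i (upper i).
Proof.
move=> qN out F0; rewrite (big_ord_widen N (fun i => F i (upper i)) qN) [RHS]big_mkcond.
by apply: eq_bigr => -[i iN] _ /=; case: ltnP => // qi; rewrite out.
Qed.

End ShiftedGraph.

(** * Compression *)

Section Compression.
Variable n : nat.
Implicit Types (e : rel 'I_n) (i j x y z w : 'I_n).

Definition simple e := symmetric e /\ irreflexive e.
Definition deg e x := \sum_y e x y.
Definition tri e x y z : bool := [&& e x y, e y z & e x z].

(** Ordered triples make compression easy to analyse; sorted triples occur in
    the count for shifted graphs and in the probability. *)
Lemma sum_tri_sorted e : simple e ->
  \sum_x \sum_y \sum_z tri e x y z =
  6 * \sum_(x < n) \sum_(y < n) \sum_(z < n) [&& x < y, y < z & tri e x y z].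
Proof.
move=> [symE irrE].
pose G x y z : nat := [&& x < y, y < z & tri e x y z].
have split6 x y z : nat_of_bool (tri e x y z) =
    G x y z + G x z y + G y x z + G y z x + G z x y + G z y x.
  rewrite /G /tri [e y x]symE [e z x]symE [e z y]symE.
  have [xy|yx|/val_inj->] := ltngtP x y; last by rewrite irrE !andbF.
    have [yz|zy|/val_inj->] := ltngtP y z; last by rewrite irrE !andbF.
      have [xz|zx|/val_inj->] := ltngtP x z; last by rewrite irrE !andbF.
        by rewrite /= !(addn0, add0n).
      by lia.
    have [xz|zx|/val_inj->] := ltngtP x z; last by rewrite irrE !andbF.
      by rewrite /= !(addn0, add0n); case: (e x y); case: (e x z); case: (e y z).
    by rewrite /= !(addn0, add0n); case: (e x y); case: (e x z); case: (e y z).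
  have [yz|zy|/val_inj->] := ltngtP y z; last by rewrite irrE !andbF.
    have [xz|zx|/val_inj->] := ltngtP x z; last by rewrite irrE !andbF.
      by rewrite /= !(addn0, add0n); case: (e x y); case: (e x z); case: (e y z).
    by rewrite /= !(addn0, add0n); case: (e x y); case: (e x z); case: (e y z).
  have [xz|zx|/val_inj->] := ltngtP x z; last by rewrite irrE !andbF.
    by lia.
  by rewrite /= !(addn0, add0n); case: (e x y); case: (e x z); case: (e y z).
under eq_bigr do under eq_bigr do under eq_bigr do rewrite split6.
do 5!(under eq_bigr do under eq_bigr do rewrite big_split /=;
      under eq_bigr do rewrite big_split /=; rewrite big_split /=).
set S := \sum_x \sum_y \sum_z G x y z.
have swap_out (H : 'I_n -> 'I_n -> nat) : \sum_x \sum_y H x y = \sum_x \sum_y H y x.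
  by rewrite exchange_big.
have S2 : \sum_x \sum_y \sum_z G x z y = S.
  by apply: eq_bigr => x _; rewrite swap_out.
have S3 : \sum_x \sum_y \sum_z G y x z = S by rewrite swap_out.
have S4 : \sum_x \sum_y \sum_z G y z x = S.
  by rewrite swap_out.
have S5 : \sum_x \sum_y \sum_z G z x y = S.
  under eq_bigr do rewrite swap_out.
  by rewrite swap_out.
have S6 : \sum_x \sum_y \sum_z G z y x = S.
  under eq_bigr do rewrite swap_out.
  by rewrite swap_out S2.
by rewrite S2 S3 S4 S5 S6 -[X in _ = _ * X]/S; lia.
Qed.

Section Shift.
Variables (e : rel 'I_n) (i j : 'I_n).
Hypotheses (se : simple e) (ij : i < j).
Let t := tperm i j.
Let nij : (i == j) = false. Proof. by rewrite -val_eqE ltn_eqF. Qed.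
Let nji : (j == i) = false. Proof. by rewrite eq_sym nij. Qed.
Let symE : symmetric e. Proof. by case: se. Qed.
Let irrE : irreflexive e. Proof. by case: se. Qed.
Let ti : t i = j. Proof. exact: tpermL. Qed.
Let tj : t j = i. Proof. exact: tpermR. Qed.

Definition moved x := (x == i) || (x == j).

(** The neighbours of j that i lacks are handed over to i: outside of i and j,
    the new neighbourhood of i is the union of the old ones, and that of j is
    their intersection. *)
Definition compress : rel 'I_n := fun x y =>
  if moved x == moved y then e x y
  else if (x == i) || (y == i) then e x y || e (t x) (t y)
  else e x y && e (t x) (t y).

Variant role x : Prop :=
| RoleI of x = i | RoleJ of x = j
| RoleO of (x == i) = false & (x == j) = false & t x = x.

Lemma roleP x : role x.
Proof.
have [xi|xi] := boolP (x == i); first by constructor 1; apply/eqP.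
have [xj|xj] := boolP (x == j); first by constructor 2; apply/eqP.
by constructor 3; rewrite ?(negPf xi) ?(negPf xj) // /t tpermD // eq_sym.
Qed.

Lemma compress_simple : simple compress.
Proof.
split=> x; last by rewrite /compress eqxx irrE.
move=> y; rewrite /compress [e y x]symE [e (t y) _]symE.
by rewrite [moved x == _]eq_sym orbC.
Qed.

(** Averaging over the exchange t of i and j turns the effect of compression into
    a pointwise statement on booleans, here for edges and below for triangles. *)
Lemma compress_pair x y : compress x y + compress (t x) (t y) = e x y + e (t x) (t y).
Proof.
rewrite /compress /moved.
case: (roleP x) => [->|->|xi xj tx]; case: (roleP y) => [->|->|yi yj ty];
  rewrite ?ti ?tj ?tx ?ty ?ti ?tj ?tx ?ty ?eqxx ?nij ?nji ?xi ?xj ?yi ?yj ?orbT /= ?tx ?ty ?ti ?tj //;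
  rewrite ?eqxx ?orbT ?nij ?nji ?xi ?xj ?yi ?yj /= ?tx ?ty ?ti ?tj //.
all: by case: (e _ _); case: (e _ _).
Qed.

Lemma sum_tperm (F : 'I_n -> nat) : \sum_x F (t x) = \sum_x F x.
Proof. by rewrite [RHS](reindex_inj (@perm_inj _ t)). Qed.

Lemma compress_deg_pair x : deg compress x + deg compress (t x) = deg e x + deg e (t x).
Proof.
rewrite /deg -(sum_tperm (compress (t x))) -(sum_tperm (e (t x))) -!big_split /=.
by apply: eq_bigr => y _; rewrite compress_pair.
Qed.

Lemma compress_deg x : ~~ moved x -> deg compress x = deg e x.
Proof.
have := compress_deg_pair x; rewrite /moved.
by case: (roleP x) => [->|->|xi xj ->]; rewrite ?eqxx ?orbT //; lia.
Qed.

Lemma compress_deg_i : (deg e i <= deg compress i) && (deg e j <= deg compress i).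
Proof.
apply/andP; split; first apply: leq_sum => y _.
  rewrite /compress /moved eqxx /=.
  by case: ifP => //; case: (e i y).
rewrite /deg -(sum_tperm (e j)) leq_sum // => y _.
rewrite /compress /moved eqxx ti /=.
case: (roleP y) => [->|->|yi yj ty]; rewrite ?eqxx ?nij ?nji ?yi ?yj ?orbT ?ti ?tj ?ty /=.
- by rewrite irrE.
- by rewrite symE; case: (e i j).
- by case: (e i y); case: (e j y).
Qed.

(** The degrees of i and j are pushed apart and the others do not change. *)
Lemma stars_compress k :
  \sum_x 'C(deg e x, k) <= \sum_x 'C(deg compress x, k).
Proof.
case: k => [|k]; first by rewrite leq_sum // => x _; rewrite !bin0.
have gc := convex0_bin k.
have spread : 'C(deg e i, k.+1) + 'C(deg e j, k.+1)
    <= 'C(deg compress i, k.+1) + 'C(deg compress j, k.+1).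
  have /andP[di dj] := compress_deg_i.
  have := compress_deg_pair i; rewrite ti => dE.
  by rewrite [X in _ <= X]addnC; apply: (convex0_spread gc); lia.
rewrite (bigD1 i) // [X in _ <= X](bigD1 i) // (bigD1 j) ?nji // [X in _ <= _ + X](bigD1 j) ?nji //=.
rewrite !addnA leq_add // leq_sum // => x /andP[xi xj].
by rewrite compress_deg // /moved negb_or xi.
Qed.

(** The only case with a strict inequality is that of one vertex among i and j:
    a union and an intersection of neighbourhoods contain together at least as
    many pairs as the two neighbourhoods. *)
Lemma tri_compress_pair x y z :
  tri e x y z + tri e (t x) (t y) (t z)
    <= tri compress x y z + tri compress (t x) (t y) (t z).
Proof.
rewrite /tri /compress /moved.
case: (roleP x) => [->|->|xi xj tx]; case: (roleP y) => [->|->|yi yj ty];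
case: (roleP z) => [->|->|zi zj tz];
  rewrite ?ti ?tj ?tx ?ty ?tz ?irrE /= ?andbF ?eqxx ?nij ?nji ?xi ?xj ?yi ?yj ?zi ?zj ?orbT /= ?tx ?ty ?tz ?ti ?tj //;
  rewrite ?irrE ?andbF /= ?eqxx ?orbT ?nij ?nji ?xi ?xj ?yi ?yj ?zi ?zj /= ?tx ?ty ?tz ?ti ?tj //.
all: rewrite ?[e x i]symE ?[e x j]symE ?[e y i]symE ?[e y j]symE ?[e z i]symE ?[e z j]symE ?[e j i]symE.
all: repeat match goal with |- context [e ?a ?b] => case: (e a b) => //= end.
Qed.

Lemma tri_compress :
  \sum_x \sum_y \sum_z tri e x y z <= \sum_x \sum_y \sum_z tri compress x y z.
Proof.
have pair (f : rel 'I_n) : 2 * \sum_x \sum_y \sum_z tri f x y z =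
    \sum_x \sum_y \sum_z (tri f x y z + tri f (t x) (t y) (t z)).
  rewrite mul2n -addnn -{2}(sum_tperm (fun x => \sum_y \sum_z tri f x y z)).
  rewrite -big_split; apply: eq_bigr => x _.
  rewrite -(sum_tperm (fun y => \sum_z tri f (t x) y z)) -big_split.
  apply: eq_bigr => y _; rewrite -(sum_tperm (fun z => tri f (t x) (t y) z)).
  by rewrite -big_split.
rewrite -(leq_pmul2l (isT : 0 < 2)) !pair.
do 3!(rewrite leq_sum // => ? _); exact: tri_compress_pair.
Qed.

Lemma edges_compress : \sum_x deg compress x = \sum_x deg e x.
Proof.
apply: double_inj; rewrite -!addnn -{2}(sum_tperm (deg compress)) -{2}(sum_tperm (deg e)).
by rewrite -!big_split; apply: eq_bigr => x _; apply: compress_deg_pair.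
Qed.

(** Edges move to earlier vertices, so repeated compression terminates. *)
Lemma potential_compress w : ~~ moved w -> e j w -> ~~ e i w ->
  \sum_(x < n) x * deg compress x < \sum_(x < n) x * deg e x.
Proof.
move=> nw jw niw.
have lt_i : deg e i < deg compress i.
  rewrite /deg (bigD1 w) // [X in _ < X](bigD1 w) //= (negPf niw).
  have -> : compress i w.
    move: nw; rewrite /compress /moved eqxx /=.
    by case: (roleP w) => [->|->|wi wj ->]; rewrite ?eqxx ?orbT // ti jw wi wj orbT.
  rewrite ltnS leq_sum // => y _; rewrite /compress /moved eqxx /=.
  by case: ifP => //; case: (e i y).
rewrite (bigD1 i) // [X in _ < X](bigD1 i) // (bigD1 j) ?nji // [X in _ < _ + X](bigD1 j) ?nji //=.
rewrite !addnA -addSn leq_add //; last first.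
  rewrite leq_sum // => x /andP[xi xj].
  by rewrite compress_deg // /moved negb_or xi.
have := compress_deg_pair i; rewrite ti; move: ij lt_i.
by case: i j => a ? [b ?] /=; nia.
Qed.

End Shift.

Definition compressed e := forall i j w, i < j -> w != i -> e j w -> e i w.

Lemma shifted_above e : simple e -> exists e', [/\ simple e', compressed e',
  \sum_x deg e' x = \sum_x deg e x,
  forall k, \sum_x 'C(deg e x, k) <= \sum_x 'C(deg e' x, k) &
  \sum_x \sum_y \sum_z tri e x y z <= \sum_x \sum_y \sum_z tri e' x y z].
Proof.
have [m] := ubnP (\sum_(x < n) x * deg e x); elim: m e => // m IHm e lt_m se.
have [sh|] := boolP [forall i : 'I_n, forall j : 'I_n, forall w : 'I_n,
    [==> i < j, w != i, e j w => e i w]].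
  exists e; split=> // i j w ij wi jw.
  by move/forallP/(_ i)/forallP/(_ j)/forallP/(_ w): sh; rewrite ij wi jw.
case/forallPn=> i /forallPn[j /forallPn[w]]; rewrite !negb_imply.
case/and4P=> ij wi jw niw.
have nw : ~~ moved i j w.
  by rewrite /moved negb_or wi; apply: contraTN jw => /eqP->; case: se => _ ->.
have [|e' [se' sh' edges st tr]] := IHm (compress e i j) _ (compress_simple _ _ se).
  by rewrite -ltnS (leq_trans _ lt_m) // ltnS (potential_compress ij nw jw niw).
exists e'; split=> //.
- by rewrite edges edges_compress.
- by move=> k; apply: leq_trans (stars_compress se ij k) (st k).
- exact: leq_trans (tri_compress se ij) tr.
Qed.
End Compression.

(** * Intersecting graphs are stars or triangles *)

Section Intersecting.
Variable n : nat.
Implicit Types (x y z u v : 'I_n) (A B : {set 'I_n}) (H G : {set {set 'I_n}}).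

Definition triangle x y z : {set {set 'I_n}} := [set [set x; y]; [set y; z]; [set x; z]].

Definition common H v := [forall A in H, v \in A].

Lemma triangleC12 x y z : triangle x y z = triangle y x z.
Proof. by apply/setP=> A; rewrite !inE [[set y; x]]setUC; case: (A == _); case: (A == _); case: (A == _). Qed.

Lemma triangleC23 x y z : triangle x y z = triangle x z y.
Proof. by apply/setP=> A; rewrite !inE [[set z; y]]setUC; case: (A == _); case: (A == _); case: (A == _). Qed.

Lemma triangle_sorted x y z : x != y -> y != z -> x != z ->
  exists x' y' z', [/\ x' < y', y' < z' & triangle x y z = triangle x' y' z'].
Proof.
have lt_gt u v : u != v -> u < v \/ v < u.
  by rewrite -val_eqE neq_ltn => /orP.
move=> /lt_gt xy /lt_gt yz /lt_gt xz.
case: xy => xy; case: yz => yz.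
- by exists x, y, z.
- case: xz => xz; first by exists x, z, y; rewrite triangleC23.
  by exists z, x, y; rewrite triangleC23 triangleC12.
- case: xz => xz; first by exists y, x, z; rewrite triangleC12.
  by exists y, z, x; rewrite triangleC12 triangleC23.
- by exists z, y, x; rewrite triangleC12 triangleC23 triangleC12.
Qed.

Lemma triangle_inj x y z x' y' z' : x < y -> y < z -> x' < y' -> y' < z' ->
  triangle x y z = triangle x' y' z' -> [/\ x = x', y = y' & z = z'].
Proof.
have coverE u v w : cover (triangle u v w) = [set u; v; w].
  rewrite /cover /triangle !bigcup_setU !big_set1.
  by apply/setP=> a; rewrite !inE; do 3!case: (a == _).
move=> xy yz x'y' y'z' /(congr1 (@cover _)); rewrite !coverE => /setP eqS.
move: (eqS x) (eqS y) (eqS z) (eqS x') (eqS y') (eqS z').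
rewrite !inE -!val_eqE /= !eqxx ?orbT /= => h1 h2 h3 h4 h5 h6.
by split; apply: val_inj => /=; lia.
Qed.

Lemma triangle_subset x y z H :
  (triangle x y z \subset H) = [&& [set x; y] \in H, [set y; z] \in H & [set x; z] \in H].
Proof. by rewrite /triangle !subUset !sub1set andbA. Qed.

Lemma card_triangle x y z : x < y -> y < z -> #|triangle x y z| = 3.
Proof.
move=> xy yz; have nxy : x != y by rewrite -val_eqE ltn_eqF.
have nyz : y != z by rewrite -val_eqE ltn_eqF.
have nxz : x != z by rewrite -val_eqE ltn_eqF // (ltn_trans xy).
have xy_yz : [set x; y] != [set y; z].
  by apply/eqP=> /setP/(_ x); rewrite !inE eqxx (negPf nxy) (negPf nxz).
have xy_xz : [set x; y] != [set x; z].
  by apply/eqP=> /setP/(_ y); rewrite !inE eqxx orbT [y == x]eq_sym (negPf nxy) (negPf nyz).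
have yz_xz : [set y; z] != [set x; z].
  by apply/eqP=> /setP/(_ y); rewrite !inE eqxx [y == x]eq_sym (negPf nxy) (negPf nyz).
by rewrite /triangle -setUA cardsU1 cards2 yz_xz !inE negb_or xy_yz xy_xz.
Qed.

Lemma common_triangle x y z v : x < y -> y < z -> ~~ common (triangle x y z) v.
Proof.
move=> xy yz; apply/negP=> /forall_inP cv.
have := cv [set x; y]; have := cv [set y; z]; have := cv [set x; z].
rewrite !inE !eqxx !orbT => /(_ isT) h1 /(_ isT) h2 /(_ isT) h3.
by move: h1 h2 h3; rewrite -!val_eqE /=; lia.
Qed.

Lemma intersecting_triangle x y z : intersecting (triangle x y z).
Proof.
apply/forall_inP=> A At; apply/forall_inP=> B Bt; apply/set0Pn.
move: At Bt; rewrite !inE -!orbA.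
case/or3P=> /eqP->; case/or3P=> /eqP->;
  first [ by exists x; rewrite !inE eqxx ?orbT
        | by exists y; rewrite !inE eqxx ?orbT
        | by exists z; rewrite !inE eqxx ?orbT ].
Qed.

Lemma pairP A a : #|A| = 2 -> a \in A -> exists2 b, b != a & A = [set a; b].
Proof.
move=> A2 aA; have /cards1P[b Ab] : #|A :\ a| == 1.
  by rewrite -eqSS -[X in _ == X]A2 (cardsD1 a A) aA.
exists b; last by rewrite -(setD1K aA) Ab.
by have : b \in A :\ a; [rewrite Ab inE | rewrite !inE => /andP[]].
Qed.

Lemma set2_sub (D : {set 'I_n}) a b : #|D| = 2 -> a != b -> a \in D -> b \in D ->
  D = [set a; b].
Proof.
move=> D2 ab aD bD; apply/esym/eqP; rewrite eqEcard subUset !sub1set aD bD D2.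
by rewrite cards2 ab.
Qed.

Lemma intersectingP H A B : intersecting H -> A \in H -> B \in H ->
  exists2 v, v \in A & v \in B.
Proof.
move=> /forall_inP IH /IH /forall_inP IA /IA /set0Pn[v].
by rewrite inE => /andP[vA vB]; exists v.
Qed.

(** Let ab be an edge.  An edge avoiding a must contain b, and one avoiding b
    must contain a; as these two edges meet, they are bc and ac.  Any further
    edge that meets ab, bc and ac contains two of the three vertices. *)
Lemma no_common_triangle H : is_graph H -> H != set0 -> intersecting H ->
  (forall v, ~~ common H v) ->
  exists x y z, [/\ x < y, y < z & H = triangle x y z].
Proof.
move=> /subsetP gH /set0Pn[A AH] IH nc.
have c2 D : D \in H -> #|D| = 2 by move=> /gH; rewrite inE => /eqP.
have avoid v : exists2 D, D \in H & v \notin D.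
  by have := nc v; rewrite negb_forall_in => /exists_inP.
have [a aA] : exists a, a \in A by apply/set0Pn; rewrite -card_gt0 c2.
have [b ba AE] := pairP (c2 _ AH) aA.
have [B BH aB] := avoid a; have [C CH bC] := avoid b.
have bB : b \in B.
  have [v] := intersectingP IH AH BH; rewrite AE !inE => /orP[]/eqP-> //.
  by rewrite (negPf aB).
have aC : a \in C.
  have [v] := intersectingP IH AH CH; rewrite AE !inE => /orP[]/eqP-> //.
  by rewrite (negPf bC).
have [c cb BE] := pairP (c2 _ BH) bB; have [d da CE] := pairP (c2 _ CH) aC.
have ca : c != a by apply: contraNneq aB => <-; rewrite BE !inE eqxx orbT.
have cd : c = d.
  have [v] := intersectingP IH BH CH; rewrite BE CE !inE.
  case/orP=> /eqP->.
    rewrite (negPf ba) /= => /eqP bd.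
    by move: bC; rewrite CE bd !inE eqxx orbT.
  by rewrite (negPf ca) => /eqP.
subst d.
have HE : H = triangle a b c.
  apply/eqP; rewrite eqEsubset triangle_subset -AE -BE -CE AH BH CH !andbT.
  apply/subsetP=> D DH; rewrite !inE; have D2 := c2 _ DH.
  have [u] := intersectingP IH AH DH; rewrite AE !inE.
  have [v] := intersectingP IH BH DH; rewrite BE !inE.
  have [w] := intersectingP IH CH DH; rewrite CE !inE.
  have ab : a != b by rewrite eq_sym.
  have bc : b != c by rewrite eq_sym.
  have ac : a != c by rewrite eq_sym.
  have [aD|aD] := boolP (a \in D); last first.
    move=> /orP[]/eqP->; first by rewrite (negPf aD).
    move=> cD _ _ /orP[]/eqP->; first by rewrite (negPf aD).
    by move=> bD; rewrite (set2_sub D2 bc bD cD) eqxx orbT.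
  move=> _ _ /orP[]/eqP-> vD _ _.
    by rewrite (set2_sub D2 ab aD vD) eqxx.
  by rewrite (set2_sub D2 ac aD vD) eqxx orbT.
have [x [y [z [xy yz tE]]]] : exists x y z, [/\ x < y, y < z & triangle a b c = triangle x y z].
  by apply: triangle_sorted => //; rewrite eq_sym.
by exists x, y, z; rewrite HE.
Qed.

(** This is 1 for a triangle and 0 otherwise; the sorted triple of vertices is
    unique. *)
Definition triangle_count H : nat :=
  \sum_(x < n) \sum_(y < n) \sum_(z < n) [&& x < y, y < z & H == triangle x y z].

Lemma triangle_count1 x y z : x < y -> y < z -> triangle_count (triangle x y z) = 1.
Proof.
move=> xy yz; rewrite /triangle_count.
have E (u v w : 'I_n) : [&& u < v, v < w & triangle x y z == triangle u v w]
    = [&& u == x, v == y & w == z].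
  apply/and3P/and3P=> [[uv vw /eqP/triangle_inj[]//-> -> ->]|].
    by rewrite !eqxx.
  by case=> /eqP-> /eqP-> /eqP->.
rewrite (bigD1 x) //= (bigD1 y) //= (bigD1 z) //= E !eqxx.
rewrite big1 => [|w wz]; last by rewrite E (negPf wz) !andbF.
rewrite big1 => [|v vy]; last by rewrite big1 // => w _; rewrite E (negPf vy) andbF.
rewrite big1 // => u ux; rewrite big1 // => v _; rewrite big1 // => w _.
by rewrite E (negPf ux).
Qed.

Lemma triangle_count0 H :
  (forall x y z, x < y -> y < z -> H <> triangle x y z) -> triangle_count H = 0.
Proof.
move=> nT; rewrite /triangle_count; do 3!(rewrite big1 // => ? _).
by apply/eqP; rewrite eqb0; apply/negP => /and3P[xy yz /eqP]; apply: nT.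
Qed.

(** The number of vertices common to all edges of H is 1 if H is a star with at
    least two edges, 2 for a single edge and n for the empty graph; the extra
    terms on both sides correct the last two cases. *)
Lemma indicator_intersecting H : is_graph H ->
  intersecting H + n * (H == set0) + (#|H| == 1)
    = \sum_(v < n) common H v + (H == set0) + triangle_count H.
Proof.
move=> gH; have c2 D : D \in H -> #|D| = 2.
  by move=> DH; have := subsetP gH D DH; rewrite inE => /eqP.
have [H0|H0] := eqVneq H set0.
  rewrite H0 cards0 triangle_count0; last first.
    by move=> x y z xy yz E0; have := card_triangle xy yz; rewrite -E0 cards0.
  have -> : intersecting (set0 : {set {set 'I_n}}).
    by apply/forall_inP=> A; rewrite inE.
  under eq_bigr => v _.
    have -> : common set0 v by apply/forall_inP=> A; rewrite inE.
    over.
  by rewrite sum_nat_const card_ord /=; lia.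
have [/existsP[v cv]|/existsPn nc] := boolP [exists v, common H v]; last first.
  rewrite (big1 _ _ (fun v => common H v : nat)); last by move=> v _; rewrite (negPf (nc v)).
  have -> : (#|H| == 1) = false.
    apply/negP=> /cards1P[A HA]; have AH : A \in H by rewrite HA inE.
    have /card_gt0P[a aA] : 0 < #|A| by rewrite c2.
    by case/negP: (nc a); apply/forall_inP=> D; rewrite HA inE => /eqP->.
  rewrite muln0 !addn0 add0n; have [IH|nI] := boolP (intersecting H).
    have [x [y [z [xy yz ->]]]] := no_common_triangle gH H0 IH nc.
    by rewrite triangle_count1.
  rewrite triangle_count0 // => x y z _ _ HE.
  by case/negP: nI; rewrite HE intersecting_triangle.
rewrite triangle_count0; last first.
  by move=> x y z xy yz HE; move: cv; rewrite HE; apply/negP; apply: common_triangle.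
have -> : intersecting H.
  apply/forall_inP=> A AH; apply/forall_inP=> B BH; apply/set0Pn; exists v.
  by rewrite inE !(forall_inP cv).
rewrite muln0 !addn0.
have [H1|H1] := boolP (#|H| == 1).
  have /cards1P[A HA] := H1.
  have -> : true + true = #|A| by rewrite c2 // HA inE.
  rewrite HA -sum1_card big_mkcond /=.
  apply: eq_bigr => u _.
  have -> : common [set A] u = (u \in A).
    apply/forall_inP/idP => [|uA D]; first by apply; rewrite inE.
    by rewrite inE => /eqP->.
  by case: (u \in A).
have [A AH] : exists A, A \in H by apply/set0Pn.
have [B BH BA] : exists2 B, B \in H & B != A.
  have : 0 < #|H :\ A|.
    by move: H1; rewrite (cardsD1 A) AH; case: #|H :\ A|.
  by case/card_gt0P=> B; rewrite !inE => /andP[BA BH]; exists B.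
rewrite (bigD1 v) //= cv big1 // => u uv; apply/eqP; rewrite eqb0; apply/negP=> cu.
case/negP: BA; apply/eqP.
have AE : A = [set u; v].
  by apply: set2_sub uv _ _; [apply: c2 | apply: (forall_inP cu) | apply: (forall_inP cv)].
rewrite AE.
by apply: set2_sub uv _ _; [apply: c2 | apply: (forall_inP cu) | apply: (forall_inP cv)].
Qed.

End Intersecting.

(** * The probability in terms of star and triangle counts *)

Section GraphRelation.
Variables (n : nat) (G : {set {set 'I_n}}).
Hypothesis gG : is_graph G.

Definition adj : rel 'I_n := fun x y => (x != y) && ([set x; y] \in G).

Lemma adj_simple : simple adj.
Proof.
by split=> x; [move=> y; rewrite /adj eq_sym setUC | rewrite /adj eqxx].
Qed.

Definition star v := [set A in G | v \in A].

Lemma card_star v : #|star v| = deg adj v.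
Proof.
have -> : star v = (fun y => [set v; y]) @: [set y | adj v y].
  apply/setP=> A; rewrite inE; apply/andP/imsetP => [[AG vA]|[y]].
    have A2 : #|A| = 2 by have := subsetP gG A AG; rewrite inE => /eqP.
    have [b bv AE] := pairP A2 vA; exists b => //.
    by rewrite inE /adj eq_sym bv -AE.
  by rewrite inE => /andP[_ vyG] ->; rewrite !inE eqxx.
rewrite card_in_imset; first by rewrite -sum1dep_card big_mkcond.
move=> y z; rewrite !inE => /andP[vy _] /andP[vz _] /setP/(_ y).
by rewrite !inE eqxx orbT eq_sym (negPf vy) /= => /esym/eqP.
Qed.

Lemma deg_adj_sum : \sum_(v < n) deg adj v = 2 * #|G|.
Proof.
under eq_bigr do rewrite -card_star -sum1_card.
rewrite (exchange_big_dep (mem G)) /=; last by move=> v A _; rewrite inE => /andP[].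
rewrite mulnC -sum_nat_const; apply: eq_bigr => A AG.
have := subsetP gG A AG; rewrite inE => /eqP <-; rewrite -sum1_card.
by apply: eq_bigl => v; rewrite inE AG.
Qed.

Definition adj_triangles : nat :=
  \sum_(x < n) \sum_(y < n) \sum_(z < n) [&& x < y, y < z & tri adj x y z].

Lemma adj_triangle (x y z : 'I_n) : x < y -> y < z ->
  (triangle x y z \subset G) = tri adj x y z.
Proof.
move=> xy yz; rewrite triangle_subset /tri /adj -!val_eqE.
by rewrite !neq_ltn xy yz (ltn_trans xy yz).
Qed.

(** The exponent of 1 - p refers to the fixed number of edges of G, so F k is the
    probability of each individual subgraph with k edges. *)
Section Law.
Local Open Scope ring_scope.
Variables (R : realType) (p : R).
Let q := 1 - p.
Let F k : R := p ^+ k * q ^+ (#|G| - k).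

Lemma subfamily_lawE (T : finType) (K H : {set {set T}}) : H \subset K ->
  subfamily_law p K H = p ^+ #|H| * (1 - p) ^+ (#|K| - #|H|).
Proof.
move=> HK; rewrite /subfamily_law (bigID (mem H)) /=; congr (_ * _).
  rewrite -prodr_const; apply: eq_big => [A|A /andP[_ ->] //].
  by apply: andb_idl => /(subsetP HK).
have -> : (#|K| - #|H|)%N = #|K :\: H| by rewrite cardsD (setIidPr HK).
rewrite -prodr_const.
apply: eq_big => [A|A /andP[_ /negPf-> //]].
by rewrite in_setD andbC.
Qed.

Lemma sum_subsets_card (T : finType) (K : {set T}) (f : nat -> R) N : (#|K| < N)%N ->
  \sum_(H in powerset K) f #|H| = \sum_(k < N) f k *+ 'C(#|K|, k).
Proof.
move=> KN; rewrite (partition_big (fun H : {set T} => inord #|H| : 'I_N.-1.+1) xpredT) //=.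
have NE : N.-1.+1 = N by rewrite prednK // (leq_ltn_trans _ KN).
rewrite -(big_mkord xpredT (fun k => f k *+ 'C(#|K|, k))) -NE big_mkord.
apply: eq_bigr => -[k kN] _ /=; rewrite -cards_draws -sumr_const.
rewrite big_mkcond [RHS]big_mkcond; apply: eq_bigr => H _; rewrite !inE.
case: (boolP (H \subset K)) => //= HK; rewrite -val_eqE /= inordK; last first.
  by rewrite NE (leq_ltn_trans _ KN) // subset_leq_card.
by case: eqP => [->|].
Qed.

Lemma sum_star v :
  \sum_(H in powerset G) F #|H| *+ common H v = \sum_(k < n.+4) F k *+ 'C(deg adj v, k).
Proof.
have lt_deg : (#|star v| < n.+4)%N.
  rewrite card_star (leq_ltn_trans (_ : _ <= \sum_(y < n) 1)%N) //; last first.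
    by rewrite sum_nat_const card_ord muln1 ltnS !leqW.
  by rewrite leq_sum // => y _; case: adj.
rewrite -card_star -(sum_subsets_card F lt_deg) [RHS]big_mkcond [LHS]big_mkcond /=.
apply: eq_bigr => H _; rewrite !inE.
have -> : (H \subset star v) = (H \subset G) && common H v.
  apply/subsetP/andP => [HS|[/subsetP HG /forall_inP Hv] A AH].
    split; first by apply/subsetP=> A /HS; rewrite inE => /andP[].
    by apply/forall_inP=> A /HS; rewrite inE => /andP[].
  by rewrite inE HG // Hv.
by case: (H \subset G); case: (common H v).
Qed.

Lemma sum_singletons : \sum_(H in powerset G) F #|H| *+ (#|H| == 1)%N = F 1 *+ #|G|.
Proof.
rewrite (sum_subsets_card (fun k => F k *+ (k == 1)%N) (ltnSn _)).
case: #|G| => [|m]; first by rewrite big_ord1 /= mulr0n.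
rewrite !big_ord_recl /= mulr0n mul0rn add0r mulr1n bin1 big1 ?addr0 // => i _.
by rewrite mulr0n mul0rn.
Qed.

Lemma sum_empty : \sum_(H in powerset G) F #|H| *+ (H == set0) = F 0.
Proof.
rewrite (bigD1 set0) ?inE ?sub0set //= eqxx cards0 mulr1n big1 ?addr0 // => H /andP[_ /negPf->].
by rewrite mulr0n.
Qed.

Lemma sum_triangles :
  \sum_(H in powerset G) F #|H| *+ triangle_count H = F 3 *+ adj_triangles.
Proof.
have pull (f g : 'I_n -> R) : (forall x, f x = g x) -> \sum_x f x = \sum_x g x.
  by move=> fg; apply: eq_bigr => x _.
transitivity (\sum_(H in powerset G) \sum_(x < n) \sum_(y < n) \sum_(z < n)
    F #|H| *+ [&& x < y, y < z & H == triangle x y z]%N).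
  apply: eq_bigr => H _; rewrite /triangle_count -sumrMnr; apply: (pull) => x.
  by rewrite -sumrMnr; apply: (pull) => y; rewrite -sumrMnr.
rewrite exchange_big /adj_triangles -sumrMnr; apply: (pull) => x.
rewrite exchange_big -sumrMnr; apply: (pull) => y.
rewrite exchange_big -sumrMnr; apply: (pull) => z /=.
have [xy|_] := ltnP x y; last by rewrite mulr0n big1.
have [yz|_] := ltnP y z; last by rewrite mulr0n big1.
rewrite /= -adj_triangle //; case: (boolP (_ \subset G)) => tG.
  rewrite (bigD1 (triangle x y z)) ?inE //= eqxx card_triangle // big1 ?addr0 // => H /andP[_ /negPf->].
  by rewrite mulr0n.
rewrite big1 // => H; rewrite inE; case: eqP => [->|//].
by rewrite (negPf tG).
Qed.

(** The summation bound n.+4 exceeds all degrees and includes the index 3 also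
    for small n. *)
Lemma intersecting_probE :
  subfamily_prob p G (@intersecting 'I_n) + F 0 *+ n + F 1 *+ #|G|
  = \sum_(k < n.+4) F k *+ (\sum_x 'C(deg adj x, k)) + F 0 + F 3 *+ adj_triangles.
Proof.
rewrite -sum_singletons -sum_triangles -sum_empty -sumrMnl.
have -> : subfamily_prob p G (@intersecting 'I_n)
    = \sum_(H in powerset G) F #|H| *+ intersecting H.
  rewrite /subfamily_prob big_mkcondr /=; apply: eq_bigr => H.
  rewrite inE => HG; rewrite subfamily_lawE //.
  by case: (intersecting H).
have -> : \sum_(k < n.+4) F k *+ (\sum_x 'C(deg adj x, k))
    = \sum_(H in powerset G) F #|H| *+ \sum_(v < n) common H v.
  under [RHS]eq_bigr do rewrite -sumrMnr.
  rewrite [RHS]exchange_big /=; under [RHS]eq_bigr do rewrite sum_star.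
  by rewrite [RHS]exchange_big /=; apply: eq_bigr => k _; rewrite -sumrMnr.
rewrite -!big_split /=; apply: eq_bigr => H; rewrite inE => HG.
have := indicator_intersecting (subset_trans HG gG).
by rewrite -mulrnA -!mulrnDr mulnC => ->.
Qed.
End Law.
End GraphRelation.

(** * Lexicographic graphs *)

Section Lex.
Variable n : nat.
Implicit Types A B C : {set 'I_n}.

Lemma in_symdiff A B (i : 'I_n) : (i \in symdiff A B) = ((i \in A) != (i \in B)).
Proof. by rewrite !inE; case: (i \in A); case: (i \in B). Qed.

(** The sets agree below i and the first difference i belongs to A; in this form
    transitivity is a comparison of first differences. *)
Lemma lex_ltP A B : reflect
  (exists i : 'I_n, [/\ i \in A, i \notin B & forall j : 'I_n, j < i -> (j \in A) = (j \in B)])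
  (lex_lt A B).
Proof.
apply: (iffP exists_inP) => [[i iAB /andP[/forall_inP imin iA]]|[i [iA iB imin]]]; exists i.
- move: iAB; rewrite in_symdiff iA => iB; split=> //.
  move=> j ji; apply/eqP; apply/negPn/negP; rewrite -in_symdiff => /imin.
  by rewrite leqNgt ji.
- by rewrite in_symdiff iA (negPf iB).
- rewrite iA andbT; apply/forall_inP=> j; rewrite in_symdiff leqNgt.
  by apply: contra => /imin ->.
Qed.

Lemma lex_le_refl : reflexive (@lex_le n).
Proof. by move=> A; rewrite /lex_le eqxx. Qed.

Lemma lex_le_total : total (@lex_le n).
Proof.
move=> A B; rewrite /lex_le [B == A]eq_sym; case: eqVneq => //= AB.
have /set0Pn[i0 i0P] : symdiff A B != set0.
  apply: contraNneq AB => S0; apply/eqP/setP=> i.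
  by apply/eqP/negPn; rewrite -in_symdiff S0 inE.
case: (arg_minnP (fun i : 'I_n => i : nat) i0P) => i iP imin.
have low (j : 'I_n) : j < i -> (j \in A) = (j \in B).
  move=> ji; apply/eqP/negPn/negP; rewrite -in_symdiff => /imin.
  by rewrite leqNgt ji.
move: iP; rewrite -[_ i]/(i \in symdiff A B) in_symdiff.
case iA: (i \in A); case iB: (i \in B) => // _; apply/orP.
  by left; apply/lex_ltP; exists i; rewrite iB.
by right; apply/lex_ltP; exists i; rewrite iA; split=> // j /low.
Qed.

Lemma lex_lt_asym A B : lex_lt A B -> ~~ lex_le B A.
Proof.
move=> /lex_ltP[i [iA iB low]]; rewrite /lex_le negb_or.
apply/andP; split; first by apply: contraNneq iB => ->.
apply/negP=> /lex_ltP[j [jB jA lowj]].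
have [ij|ji|/val_inj ij] := ltngtP i j.
- by rewrite (lowj i ij) iA in iB.
- by rewrite (low j ji) jB in jA.
- by rewrite ij jB in iB.
Qed.

Lemma lex_le_trans : transitive (@lex_le n).
Proof.
move=> B A C; rewrite /lex_le.
case/predU1P=> [-> //|AB]; case/predU1P=> [<-|BC]; first by rewrite AB orbT.
apply/orP; right; move: AB BC => /lex_ltP[i [iA iB low]] /lex_ltP[j [jB jC lowj]].
apply/lex_ltP; have [ij|ji|/val_inj ij] := ltngtP i j.
- by exists i; split=> //; [rewrite -(lowj i ij) | move=> k ki; rewrite low // lowj // (ltn_trans ki)].
- by exists j; split=> //; [rewrite (low j ji) | move=> k kj; rewrite low ?lowj // (ltn_trans kj)].
- by rewrite ij jB in iB.
Qed.

Lemma lex_family_initial k m A B : A \in lex_family n k m -> #|B| = k ->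
  lex_lt B A -> B \in lex_family n k m.
Proof.
rewrite !inE => Am Bk BA; set s := sort _ _ in Am *.
have As : A \in s := mem_take Am.
have Bs : B \in s by rewrite mem_sort mem_enum inE Bk.
rewrite in_take //; rewrite in_take // in Am.
apply: leq_ltn_trans Am; rewrite leqNgt; apply/negP=> AB.
case/negP: (lex_lt_asym BA).
apply: (sorted_leq_index lex_le_trans lex_le_refl (sort_sorted lex_le_total _) A B As Bs).
exact: ltnW.
Qed.

Lemma card_lex_family k m : m <= 'C(n, k) -> #|lex_family n k m| = m.
Proof.
move=> mC; rewrite cardsE; have /card_uniqP -> : uniq (take m (sort (@lex_le n) (enum (ksubsets n k)))).
  by rewrite take_uniq // sort_uniq enum_uniq.
by rewrite size_take size_sort -cardE card_draws card_ord; case: ltngtP mC.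
Qed.

Lemma lex_family_graph m : is_graph (lex_family n 2 m).
Proof.
by apply/subsetP=> A; rewrite inE => /mem_take; rewrite mem_sort mem_enum.
Qed.

Lemma lex_adj_compressed m : compressed (adj (lex_family n 2 m)).
Proof.
move=> i j w ij wi /andP[jw jwL]; rewrite /adj eq_sym wi /=.
apply: lex_family_initial jwL _ _; first by rewrite cards2 eq_sym wi.
apply/lex_ltP; exists i; rewrite !inE eqxx; split=> //.
  by rewrite negb_or [i == w]eq_sym wi andbT -val_eqE ltn_eqF.
move=> k ki; rewrite !inE -!val_eqE (ltn_eqF ki).
by rewrite (ltn_eqF (ltn_trans ki ij)).
Qed.

(** A lexicographic graph uses up a vertex before it starts with the next one. *)
Lemma lex_adj_full m (i j i' j' : 'I_n) : i < i' -> i' < j' -> i < j ->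
  adj (lex_family n 2 m) i' j' -> adj (lex_family n 2 m) i j.
Proof.
move=> ii' ij' ij /andP[_ L']; have nij : i != j by rewrite -val_eqE ltn_eqF.
rewrite /adj nij /=; apply: lex_family_initial L' _ _; first by rewrite cards2 nij.
apply/lex_ltP; exists i; rewrite !inE eqxx; split=> //.
  by rewrite negb_or -!val_eqE !ltn_eqF // (ltn_trans ii').
move=> k ki; rewrite !inE -!val_eqE !(ltn_eqF _) //.
- exact: ltn_trans ki (ltn_trans ii' ij').
- exact: ltn_trans ki ii'.
- exact: ltn_trans ki ij.
Qed.
End Lex.

Section Transfer.
Variables (c : nat) (e : rel 'I_c.+1).
Hypotheses (se : simple e) (she : compressed e).

Definition nat_adj a b := e (inord a) (inord b).

Lemma nat_adj_shifted : shifted c.+1 nat_adj.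
Proof.
have [sym irr] := se; split=> [a b|a|i j w ij jc wc wi]; rewrite /nat_adj.
- exact: sym.
- exact: irr.
- apply: she; first by rewrite !inordK // (ltn_trans ij).
  by rewrite -val_eqE /= !inordK // (ltn_trans ij).
Qed.

Lemma nat_adj_degree (v : 'I_c.+1) : degree c.+1 nat_adj v = deg e v.
Proof. by apply: eq_bigr => w _; rewrite /nat_adj !inord_val. Qed.

Lemma nat_adj_stars k : \sum_x 'C(deg e x, k) = stars c.+1 nat_adj k.
Proof. by apply: eq_bigr => v _; rewrite nat_adj_degree. Qed.

Lemma nat_adj_triangles :
  \sum_x \sum_y \sum_z tri e x y z = 6 * triangles c.+1 nat_adj.
Proof.
rewrite (sum_tri_sorted se); congr (_ * _).
by do 3!(apply: eq_bigr => ? _); rewrite /nat_adj !inord_val.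
Qed.

Lemma nat_adj_size : \sum_x deg e x = 2 * \sum_(v < c.+1) upper c.+1 nat_adj v.
Proof.
rewrite -(degree_sum nat_adj_shifted).
by apply: eq_bigr => v _; rewrite nat_adj_degree.
Qed.

Lemma weight_rows g b q : q <= c.+1 ->
  (forall i, q <= i -> upper c.+1 nat_adj i = 0) ->
  weight g b c.+1 (upper c.+1 nat_adj) = weight g b q (upper c.+1 nat_adj).
Proof.
move=> qc out; rewrite /weight (sum_rows (F := fun i u => row_weight g b i u) qc out) //.
by move=> i; rewrite /row_weight big_ord0.
Qed.

Lemma shifted_weight_le g b r s : convex0 g -> b <= 1 -> 0 < s <= c - r ->
  32 * r.+1 <= c.+1 -> \sum_x deg e x = 2 * lex_size c r s ->
  weight g b c.+1 (upper c.+1 nat_adj) <= lex_weight g b c r s.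
Proof.
move=> gc b1 sr rc; rewrite nat_adj_size => /eqP; rewrite eqn_pmul2l // => /eqP sz.
have [q qc [rows out]] := upper_rows nat_adj_shifted.
rewrite (weight_rows g b qc out); apply: weight_le_lex => //.
  by have := upper_bound nat_adj (ltn0Sn c); rewrite add0n ltnS.
by rewrite -sz (sum_rows (F := fun i u => u) qc out).
Qed.

(** The hypothesis makes every nonempty row force the rows above it to be full. *)
Lemma full_rows :
  (forall i j i' j' : 'I_c.+1, i < i' -> i' < j' -> i < j -> e i' j' -> e i j) ->
  0 < \sum_x deg e x ->
  exists r s, [/\ 0 < s <= c - r, \sum_x deg e x = 2 * lex_size c r s
    & forall g b, weight g b c.+1 (upper c.+1 nat_adj) = lex_weight g b c r s].
Proof.
move=> full; rewrite nat_adj_size => pos.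
have sh := nat_adj_shifted.
have [q qc [rows out]] := upper_rows sh.
rewrite (sum_rows (F := fun i u => u) qc out) // in pos *.
case: q qc rows out pos => [|r] rc rows out pos; first by rewrite big_ord0 in pos.
have s0 : 0 < upper c.+1 nat_adj r := rows.2 r (ltnSn r).
have fullE i : i < r -> upper c.+1 nat_adj i = c - i.
  move=> ir; have := upper_bound nat_adj (ltn_trans ir rc); rewrite ltnS => ub.
  have rub := upper_bound nat_adj rc.
  have rE : nat_adj r r.+1 by rewrite (shifted_upper sh); lia.
  have : nat_adj i c.
    apply: full rE; rewrite !inordK //; lia.
  by rewrite (shifted_upper sh) //; lia.
exists r, (upper c.+1 nat_adj r); split.
- by rewrite s0; have := upper_bound nat_adj rc; lia.
- rewrite big_ord_recr /lex_size /=; congr (_ * (_ + _)).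
  by apply: eq_bigr => -[i ir] _ /=; rewrite fullE.
- move=> g b; rewrite (weight_rows g b rc out) weightS; congr (_ + _).
  by apply: eq_bigr => -[i ir] _ /=; rewrite fullE.
Qed.
End Transfer.

Lemma lex_size_cover c l : l <= c.+1 ->
  \sum_(i < l) (c - i) + 'C(c.+1 - l, 2) = 'C(c.+1, 2).
Proof.
elim: l => [|l IHl] lc; first by rewrite big_ord0 subn0.
rewrite big_ord_recr /= -IHl ?(ltnW lc) // -addnA; congr (_ + _).
by rewrite subSS [in RHS]subSn // binS bin1 addnC.
Qed.

Theorem theorem1p3 (R : realType) (n l m : nat) :
  (1 <= n)%N -> (32 * l <= n)%N -> (m <= 'C(n, 2) - 'C(n - l, 2))%N ->
  @most_probably_intersecting_graph R n m (lex_family n 2 m).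
Proof.
case: n => [//|c] _ lc ml; set L := lex_family _ _ _.
have cardL : #|L| = m by rewrite card_lex_family // (leq_trans ml) ?leq_subr.
have gL : is_graph L := lex_family_graph _ _.
split=> // p G /andP[p0 p1] gG cardG.
have [m0|m_pos] := posnP m.
  have -> : G = L by apply/eqP; move: cardG cardL; rewrite m0 => /cards0_eq-> /cards0_eq->.
  exact: lexx.
have shL : compressed (adj L) := @lex_adj_compressed _ _.
have eL := deg_adj_sum gL; rewrite cardL in eL.
have [|r [s [sr sz wL]]] := full_rows (adj_simple L) shL (@lex_adj_full _ _).
  by rewrite eL muln_gt0.
have mE : m = lex_size c r s by apply/eqP; rewrite -(eqn_pmul2l (isT : 0 < 2)) -eL sz.
have rc : 32 * r.+1 <= c.+1.
  (* the edges that meet l vertices suffice, so fewer than l rows are full *)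
  apply: leq_trans lc; rewrite leq_mul2l /= ltnNge; apply/negP => lr.
  have lec : l <= c.+1 by lia.
  move: ml; rewrite -(lex_size_cover lec) addnK mE /lex_size.
  rewrite -(subnKC lr) big_split_ord /=; case/andP: sr; lia.
have [e [se she ee st tr]] := shifted_above (adj_simple G).
have eG := deg_adj_sum gG; rewrite cardG in eG.
have sze : \sum_x deg e x = 2 * lex_size c r s by rewrite ee eG mE.
have she' := nat_adj_shifted se she; have shL' := nat_adj_shifted (adj_simple L) shL.
have le_stars k : \sum_x 'C(deg (adj G) x, k.+2) <= \sum_x 'C(deg (adj L) x, k.+2).
  apply: leq_trans (st _) _; rewrite !nat_adj_stars.
  rewrite (starsE she') (starsE shL') wL.
  by apply: shifted_weight_le => //; apply: convex0_bin.
have le_tri : \sum_x 'C(deg (adj G) x, 3) + adj_triangles G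
    <= \sum_x 'C(deg (adj L) x, 3) + adj_triangles L.
  apply: (@leq_trans (\sum_x 'C(deg e x, 3) + triangles c.+1 (nat_adj e))).
    rewrite leq_add ?st // -(leq_pmul2l (isT : 0 < 6)) -nat_adj_triangles //.
    by rewrite -(sum_tri_sorted (adj_simple G)).
  have -> : adj_triangles L = triangles c.+1 (nat_adj (adj L)).
    apply/eqP; rewrite -(eqn_pmul2l (isT : 0 < 6)) -(nat_adj_triangles (adj_simple L)).
    by rewrite -(sum_tri_sorted (adj_simple L)).
  rewrite !nat_adj_stars (stars_trianglesE she') (stars_trianglesE shL') wL.
  by rewrite shifted_weight_le //; apply: (convex0_bin 1).
pose F k : R := (p ^+ k * (1 - p) ^+ (m - k))%R.
have F_ge0 k : (0 <= F k)%R by rewrite mulr_ge0 ?exprn_ge0 ?subr_ge0.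
have PG := intersecting_probE gG p; rewrite cardG -/(F _) in PG.
have PL := intersecting_probE gL p; rewrite cardL in PL.
(* the terms with k = 3 and the triangles have to be compared together *)
rewrite -(lerD2r (F 0 *+ c.+1)) -(lerD2r (F 1 *+ m)) PG PL.
rewrite [leLHS]addrAC [leRHS]addrAC lerD2r.
have i3 : 3 < c.+1.+4 by [].
rewrite (bigD1 (Ordinal i3)) // [X in (_ <= X + _)%R](bigD1 (Ordinal i3)) //=.
rewrite addrAC [leRHS]addrAC -!mulrnDr lerD //.
  by apply: ler_wpMn2l => //; apply: F_ge0.
apply: ler_sum => -[k kc] /= _; apply: ler_wpMn2l; first exact: F_ge0.
case: k kc => [|[|k]] _ //; first by rewrite leq_sum // => x _; rewrite !bin0.
under eq_bigr do rewrite bin1; under [leqRHS]eq_bigr do rewrite bin1.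
by rewrite eG eL.
Qed.
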